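(* Let $X$ be an infinite dimensional complex Banach space with a normalized Schauder basis $(e_j)_{j=1}^{\infty}$, and let $\boldsymbol{r} = (r_n)_{n=1}^\infty$ be a sequence of positive real numbers with $\inf_{n\in\mathbb{N}} r_n >0$. Then $\mathcal{H}^\infty (\mathbb{D}_X (\boldsymbol{r}))$ and $\mathcal{H}^\infty (B_{c_0})$ are isometrically isomorphic (as Banach algebras).
   Context: $(e_j^* )_{j=1}^\infty$ denotes the coefficient functionals of the basis $(e_j)$, and normalized means $\|e_j\|=1$ for all $j$. Define $$\mathbb{D}_X (\boldsymbol{r})= \Big\{ x \in X : x = \sum_{j=1}^{\infty} e_j^* (x) e_j \text{ with } |e_j^*(x)| < r_j \text{ for every } j \in \mathbb{N} \Big\};$$ this is an open subset of $X$ when $\inf_n r_n>0$. $B_{c_0}$ is the open unit ball of the complex space $c_0$. For an open subset $U$ of a complex Banach space, $\mathcal{H}^\infty(U)$ is the Banach algebra of all bounded holomorphic functions $U\to\mathbb{C}$ with the supremum norm on $U$ and pointwise operations. ''Isometrically isomorphic as Banach algebras'' means that there is a surjective linear isometry between them that is also multiplicative. *)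

(* Defs.v *)
From Stdlib Require Export Reals.
From Stdlib Require Import Lra Lia ClassicalEpsilon ProofIrrelevance FunctionalExtensionality.
From Coquelicot Require Export Coquelicot.
Open Scope R_scope.

(** * Schauder bases *)

(** [sum_n] has [S n] terms; taking zero vectors, this also covers dimension 0. *)
Definition finite_dimensional (X : NormedModule C_AbsRing) : Prop :=
  exists (n : nat) (v : nat -> X), forall x : X,
    exists c : nat -> C, x = sum_n (fun i => scal (c i) (v i)) n.

Definition infinite_dimensional (X : NormedModule C_AbsRing) : Prop :=
  ~ finite_dimensional X.

Definition schauder_basis {X : NormedModule C_AbsRing} (e : nat -> X) : Prop :=
  forall x : X, exists! c : nat -> C, is_series (fun j => scal (c j) (e j)) x.

Definition normalized {X : NormedModule C_AbsRing} (e : nat -> X) : Prop :=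
  forall j : nat, norm (e j) = 1.

(** [coef e j] is the coefficient functional [e_j^*]; it is meaningful when [e]
    is a Schauder basis, the chosen expansion being then the only one. *)
Definition coef {X : NormedModule C_AbsRing} (e : nat -> X) (j : nat) (x : X) : C :=
  epsilon (inhabits (fun _ : nat => RtoC 0))
    (fun c : nat -> C => is_series (fun i => scal (c i) (e i)) x) j.

Lemma coef_series {X : NormedModule C_AbsRing} (e : nat -> X) (x : X) :
  schauder_basis e -> is_series (fun j => scal (coef e j x) (e j)) x.
Proof.
intros He; destruct (He x) as [c [Hc _]].
exact (epsilon_spec (inhabits (fun _ : nat => RtoC 0))
  (fun c : nat -> C => is_series (fun i => scal (c i) (e i)) x)
  (ex_intro _ c Hc)).
Qed.

Definition polydisc {X : NormedModule C_AbsRing} (e : nat -> X) (r : nat -> R)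
    (x : X) : Prop :=
  is_series (fun j => scal (coef e j x) (e j)) x /\
  forall j : nat, Cmod (coef e j x) < r j.

(** * The algebra of bounded holomorphic functions *)

(** Holomorphic means complex Frechet differentiable at every point.  An element
    of [Hinf U] is a function on [U], represented by its extension by [0] to the
    whole space, so that equality in [Hinf U] is equality on [U].  Since [U] is
    meant to be open, differentiability at the points of [U] does not depend on
    the values outside [U]. *)
Record Hinf {V : NormedModule C_AbsRing} (U : V -> Prop) : Type := mkHinf {
  Hfun :> V -> C;
  Hfun_holo : forall x : V, U x -> ex_filterdiff Hfun (locally x);
  Hfun_bounded : exists M : R, forall x : V, U x -> Cmod (Hfun x) <= M;
  Hfun_out : forall x : V, ~ U x -> Hfun x = RtoC 0
}.
Arguments mkHinf {V U} _ _ _ _.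
Arguments Hfun {V U} _ _.
Arguments Hfun_holo {V U} _ _ _.
Arguments Hfun_bounded {V U} _.
Arguments Hfun_out {V U} _ _ _.

Lemma Hinf_ext {V : NormedModule C_AbsRing} {U : V -> Prop} (f g : Hinf U) :
  (forall x, U x -> f x = g x) -> f = g.
Proof.
destruct f as [f f1 f2 f3], g as [g g1 g2 g3]; simpl; intros H.
assert (E : f = g).
{ apply functional_extensionality; intros x.
  destruct (excluded_middle_informative (U x)) as [h|h]; [now apply H|].
  now rewrite f3, g3. }
subst g; f_equal; apply proof_irrelevance.
Qed.

Definition Hinf_add {V : NormedModule C_AbsRing} {U : V -> Prop} (f g : Hinf U) :
  Hinf U.
Proof.
refine (mkHinf (fun x => Cplus (f x) (g x)) _ _ _).
- intros x Ux.
  destruct (Hfun_holo f x Ux) as [lf Hf], (Hfun_holo g x Ux) as [lg Hg].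
  exists (fun t => Cplus (lf t) (lg t)).
  exact (filterdiff_plus_fct f g lf lg Hf Hg).
- destruct (Hfun_bounded f) as [M HM], (Hfun_bounded g) as [N HN].
  exists (M + N); intros x Ux.
  eapply Rle_trans; [apply Cmod_triangle|].
  now apply Rplus_le_compat; [apply HM|apply HN].
- intros x Ux; rewrite (Hfun_out f x Ux), (Hfun_out g x Ux); apply Cplus_0_l.
Defined.

Definition Hinf_scal {V : NormedModule C_AbsRing} {U : V -> Prop} (k : C)
  (f : Hinf U) : Hinf U.
Proof.
refine (mkHinf (fun x => Cmult k (f x)) _ _ _).
- intros x Ux; destruct (Hfun_holo f x Ux) as [lf Hf].
  exists (fun t => Cmult k (lf t)).
  exact (filterdiff_scal_r_fct (K := C_AbsRing) (V := C_NormedModule)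
           k f lf Cmult_comm Hf).
- destruct (Hfun_bounded f) as [M HM].
  exists (Cmod k * M); intros x Ux.
  rewrite Cmod_mult; apply Rmult_le_compat_l; [apply Cmod_ge_0|now apply HM].
- intros x Ux; rewrite (Hfun_out f x Ux); apply Cmult_0_r.
Defined.

(** The two normed structures Coquelicot puts on [C] have the same norm, hence
    the same differentials, but are not convertible. *)
Lemma filterdiff_C_AbsRing {V : NormedModule C_AbsRing} (f : V -> C)
  (F : (V -> Prop) -> Prop) (l : V -> C) :
  filterdiff (V := C_NormedModule) f F l <->
  filterdiff (V := AbsRing_NormedModule C_AbsRing) f F l.
Proof. split; intros [[h1 h2 h3] h4]; (split; [split; assumption|exact h4]). Qed.

Definition Hinf_mul {V : NormedModule C_AbsRing} {U : V -> Prop} (f g : Hinf U) :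
  Hinf U.
Proof.
refine (mkHinf (fun x => Cmult (f x) (g x)) _ _ _).
- intros x Ux.
  destruct (Hfun_holo f x Ux) as [lf Hf], (Hfun_holo g x Ux) as [lg Hg].
  exists (fun t => Cplus (Cmult (lf t) (g x)) (Cmult (f x) (lg t))).
  apply filterdiff_C_AbsRing in Hf; apply filterdiff_C_AbsRing in Hg.
  apply filterdiff_C_AbsRing.
  exact (filterdiff_mult_fct (K := C_AbsRing) f g x lf lg Cmult_comm Hf Hg).
- destruct (Hfun_bounded f) as [M HM], (Hfun_bounded g) as [N HN].
  exists (M * N); intros x Ux.
  rewrite Cmod_mult.
  now apply Rmult_le_compat; try apply Cmod_ge_0; [apply HM|apply HN].
- intros x Ux; rewrite (Hfun_out f x Ux); apply Cmult_0_l.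
Defined.

Definition Hinf_norm {V : NormedModule C_AbsRing} {U : V -> Prop} (f : Hinf U) : R :=
  real (Lub_Rbar (fun t => exists x : V, U x /\ t = Cmod (f x))).

Definition isometrically_isomorphic_Hinf {V W : NormedModule C_AbsRing}
    (U : V -> Prop) (U' : W -> Prop) : Prop :=
  exists T : Hinf U -> Hinf U',
    (forall f g, T (Hinf_add f g) = Hinf_add (T f) (T g)) /\
    (forall k f, T (Hinf_scal k f) = Hinf_scal k (T f)) /\
    (forall f g, T (Hinf_mul f g) = Hinf_mul (T f) (T g)) /\
    (forall f, Hinf_norm (T f) = Hinf_norm f) /\
    (forall g, exists f, T f = g).

(** * The complex space c_0, with the supremum norm *)

Record c0 : Type := mkc0 {
  c0_seq :> nat -> C;
  c0_lim : filterlim c0_seq eventually (locally (RtoC 0))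
}.

Lemma c0_ext (x y : c0) : (forall n, x n = y n) -> x = y.
Proof.
destruct x as [x hx], y as [y hy]; simpl; intros H.
assert (E : x = y) by now apply functional_extensionality.
subst y; f_equal; apply proof_irrelevance.
Qed.

Definition c0_zero : c0.
Proof. exists (fun _ => RtoC 0); apply filterlim_const. Defined.

Definition c0_plus (x y : c0) : c0.
Proof.
exists (fun n => Cplus (x n) (y n)).
rewrite <- (Cplus_0_l (RtoC 0)).
eapply (filterlim_comp_2 (G := locally (RtoC 0)) (H := locally (RtoC 0)));
  [apply c0_lim|apply c0_lim|].
exact (filterlim_plus (V := C_NormedModule) (RtoC 0) (RtoC 0)).
Defined.

Definition c0_scal (k : C) (x : c0) : c0.
Proof.
exists (fun n => Cmult k (x n)).
rewrite <- (Cmult_0_r k).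
eapply filterlim_comp; [apply c0_lim|].
exact (filterlim_scal_r (V := C_NormedModule) k (RtoC 0)).
Defined.

Definition c0_opp (x : c0) : c0 := c0_scal (Copp (RtoC 1)) x.

Definition c0_norm (x : c0) : R := real (Sup_seq (fun n => Finite (Cmod (x n)))).

Lemma c0_norm_sup (x : c0) :
  is_sup_seq (fun n => Finite (Cmod (x n))) (Finite (c0_norm x)).
Proof.
unfold c0_norm.
destruct (filterlim_bounded (V := C_NormedModule) (c0_seq x)
  (ex_intro _ (RtoC 0) (c0_lim x))) as [M HM].
pose proof (Sup_seq_correct (fun n => Finite (Cmod (x n)))) as Hs.
destruct (Sup_seq (fun n => Finite (Cmod (x n)))) as [l| |]; simpl.
- exact Hs.
- destruct (Hs M) as [n Hn].
  exfalso; apply (Rlt_not_le _ _ Hn), HM.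
- exfalso; apply (Rlt_not_le _ _ (Hs 0 O)), Cmod_ge_0.
Qed.

Lemma c0_norm_ub (x : c0) (n : nat) : Cmod (x n) <= c0_norm x.
Proof.
apply Rnot_lt_le; intros H.
assert (Hp : 0 < Cmod (x n) - c0_norm x) by lra.
destruct (c0_norm_sup x (mkposreal _ Hp)) as [H1 _].
specialize (H1 n); simpl in H1; lra.
Qed.

Lemma c0_norm_lub (x : c0) (M : R) :
  (forall n, Cmod (x n) <= M) -> c0_norm x <= M.
Proof.
intros HM; apply Rnot_lt_le; intros H.
assert (Hp : 0 < c0_norm x - M) by lra.
destruct (c0_norm_sup x (mkposreal _ Hp)) as [_ [n Hn]].
specialize (HM n); simpl in Hn; lra.
Qed.

Lemma c0_norm_triangle (x y : c0) : c0_norm (c0_plus x y) <= c0_norm x + c0_norm y.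
Proof.
apply c0_norm_lub; intros n; simpl.
eapply Rle_trans; [apply Cmod_triangle|].
apply Rplus_le_compat; apply c0_norm_ub.
Qed.

Lemma c0_norm_scal (k : C) (x : c0) : c0_norm (c0_scal k x) <= Cmod k * c0_norm x.
Proof.
apply c0_norm_lub; intros n; simpl.
rewrite Cmod_mult; apply Rmult_le_compat_l; [apply Cmod_ge_0|apply c0_norm_ub].
Qed.

Lemma c0_norm_eq_0 (x : c0) : c0_norm x = 0 -> x = c0_zero.
Proof.
intros H; apply c0_ext; intros n; simpl.
apply Cmod_eq_0, Rle_antisym; [rewrite <- H; apply c0_norm_ub|apply Cmod_ge_0].
Qed.

Definition c0_AbelianMonoid_mixin : AbelianMonoid.mixin_of c0.
Proof.
apply (AbelianMonoid.Mixin c0 c0_plus c0_zero).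
- intros x y; apply c0_ext; intros n; apply Cplus_comm.
- intros x y z; apply c0_ext; intros n; apply Cplus_assoc.
- intros x; apply c0_ext; intros n; apply Cplus_0_r.
Defined.

Canonical c0_AbelianMonoid := AbelianMonoid.Pack c0 c0_AbelianMonoid_mixin c0.

Definition c0_AbelianGroup_mixin : AbelianGroup.mixin_of c0_AbelianMonoid.
Proof.
apply (AbelianGroup.Mixin c0_AbelianMonoid c0_opp).
intros x; apply c0_ext; intros n; simpl; ring.
Defined.

Canonical c0_AbelianGroup := AbelianGroup.Pack c0
  (AbelianGroup.Class c0 c0_AbelianMonoid_mixin c0_AbelianGroup_mixin) c0.

Definition c0_ModuleSpace_mixin : ModuleSpace.mixin_of C_Ring c0_AbelianGroup.
Proof.
apply (ModuleSpace.Mixin C_Ring c0_AbelianGroup c0_scal).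
- intros k l x; apply c0_ext; intros n; apply Cmult_assoc.
- intros x; apply c0_ext; intros n; apply Cmult_1_l.
- intros k x y; apply c0_ext; intros n; apply Cmult_plus_distr_l.
- intros k l x; apply c0_ext; intros n; apply Cmult_plus_distr_r.
Defined.

Definition c0_ModuleSpace_class : ModuleSpace.class_of C_Ring c0 :=
  ModuleSpace.Class C_Ring c0 (AbelianGroup.class c0_AbelianGroup)
    c0_ModuleSpace_mixin.

Canonical c0_ModuleSpace := ModuleSpace.Pack C_Ring c0 c0_ModuleSpace_class c0.

Definition c0_UniformSpace_mixin : UniformSpace.mixin_of c0.
Proof.
apply (UniformSpace.Mixin c0 c0_zero
  (fun x eps y => c0_norm (c0_plus y (c0_opp x)) < eps)).
- intros x eps.
  apply Rle_lt_trans with 0; [|apply cond_pos].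
  apply c0_norm_lub; intros n; simpl.
  replace (Cplus _ _) with (RtoC 0) by ring; rewrite Cmod_0; lra.
- intros x y eps H.
  eapply Rle_lt_trans; [|exact H].
  apply c0_norm_lub; intros n.
  eapply Rle_trans; [|apply (c0_norm_ub _ n)]; simpl.
  rewrite <- Cmod_opp; apply Req_le; f_equal; ring.
- intros x y z e1 e2 H1 H2.
  eapply Rle_lt_trans; [|exact (Rplus_lt_compat _ _ _ _ H1 H2)].
  eapply Rle_trans; [|apply c0_norm_triangle].
  apply c0_norm_lub; intros n.
  eapply Rle_trans; [|apply (c0_norm_ub _ n)]; simpl.
  apply Req_le; f_equal; ring.
Defined.

Canonical c0_UniformSpace := UniformSpace.Pack c0 c0_UniformSpace_mixin c0.

Canonical c0_NormedModuleAux := NormedModuleAux.Pack C_AbsRing c0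
  (NormedModuleAux.Class C_AbsRing c0 c0_ModuleSpace_class c0_UniformSpace_mixin) c0.

Definition c0_NormedModule_mixin : NormedModule.mixin_of C_AbsRing c0_NormedModuleAux.
Proof.
apply (NormedModule.Mixin C_AbsRing c0_NormedModuleAux c0_norm 1).
- exact c0_norm_triangle.
- exact c0_norm_scal.
- intros x y eps H; exact H.
- intros x y eps H; rewrite Rmult_1_l; exact H.
- exact c0_norm_eq_0.
Defined.

Canonical c0_NormedModule := NormedModule.Pack C_AbsRing c0
  (NormedModule.Class C_AbsRing c0
    (NormedModuleAux.class C_AbsRing c0_NormedModuleAux) c0_NormedModule_mixin) c0.

Definition open_unit_ball (V : NormedModule C_AbsRing) (x : V) : Prop := norm x < 1.

(* Main.v *)
Require Import Defs.
From Stdlib Require Import Compare_dec Lra Lia Classical ClassicalEpsilon.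

(** The coordinate map [x |-> (e_j^*(x) / r_j)_j] sends the polydisc of [X] into the unit
    ball of [c_0]; it is linear and bounded (Banach's theorem that the coefficient
    functionals of a normalized basis are equibounded), and its image is dense.
    Composition with it is therefore a multiplicative linear isometry from
    [H^oo(B_{c_0})] to [H^oo(D_X(r))], and it remains to see that it is onto.  Given [g],
    the functions [y |-> g (sum_{j <= n} r_j y_j e_j)] are holomorphic on [B_{c_0}] with a
    common bound; by the Lipschitz estimate for bounded holomorphic functions they converge
    pointwise, and a bounded pointwise limit of holomorphic functions is holomorphic.

    As the derivative is not assumed to be continuous, the one-variable estimates start
    from Goursat's theorem: it makes the circle means of [(f(z) - f(0)) / z] constant, which
    bounds [f'(0)], hence gives a Lipschitz bound.  Applied to the increments
    [z |-> f(z + h) - f(z)], that bound yields a second-order Taylor estimate. *)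

(** The coordinate map is in general not onto: for [y] in the ball of [c_0] the series of the
    [y_j r_j e_j] may diverge in [X], so [g] cannot be transported by an inverse. The finite lifts
    of [y] do lie in the polydisc, because membership only involves the moduli of the coefficients,
    but these lifts need not have a common operator bound. Equicontinuity of the functions
    [y |-> g (lift n y)] therefore has to come from the bound on [g] alone, through an estimate
    whose constant depends only on that bound and on the distance of [y] to the unit sphere.

    The choice of [c_0] as target matters: a null sequence whose entries all have modulus below 1
    has norm below 1, so the polydisc is exactly the preimage of the open ball. *)

Lemma choice {A B : Type} (P : A -> B -> Prop) :
  (forall a, exists b, P a b) -> exists f : A -> B, forall a, P a (f a).
Proof.
intros H.
exists (fun a => proj1_sig (constructive_indefinite_description _ (H a))).
intros a; exact (proj2_sig (constructive_indefinite_description _ (H a))).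
Qed.

Lemma dependent_choice {A : Type} (P : nat -> A -> Prop) (Q : nat -> A -> A -> Prop) :
  (forall n a, P n a -> exists b, P (S n) b /\ Q n a b) ->
  forall a0, P O a0 ->
  exists s : nat -> A, s O = a0 /\ forall n, P n (s n) /\ Q n (s n) (s (S n)).
Proof.
intros H a0 H0.
assert (step : forall n (a : {a | P n a}), {b : {b | P (S n) b} | Q n (proj1_sig a) (proj1_sig b)}).
{ intros n [a Pa].
  destruct (constructive_indefinite_description _ (H n a Pa)) as [b [Pb Qb]].
  now exists (exist _ b Pb). }
pose (s := fix s n : {a | P n a} := match n with
  | O => exist _ a0 H0
  | S m => proj1_sig (step m (s m)) end).
exists (fun n => proj1_sig (s n)); split; [reflexivity|]; intros n; split.
- exact (proj2_sig (s n)).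
- exact (proj2_sig (step n (s n))).
Qed.

(** * Goursat's theorem for real 1-forms *)

(** The counterclockwise line integral of the 1-form [P dx + Q dy] around the rectangle [[a, b] x
    [c, d]]. *)
Definition circulation (P Q : R -> R -> R) (a b c d : R) : R :=
  (RInt (fun x => P x c) a b + RInt (Q b) c d)
  - (RInt (fun x => P x d) a b + RInt (Q a) c d).

Lemma differentiable_pt_lim_continuous_l (f : R -> R -> R) x y lx ly :
  differentiable_pt_lim f x y lx ly -> continuous (fun u => f u y) x.
Proof.
intros H; apply (ex_derive_continuous (V := R_NormedModule)).
exists (lx * 1 + ly * 0); apply is_derive_Reals.
apply (derivable_pt_lim_comp_2d f (fun t => t) (fun _ => y)).
- exact H.
- apply derivable_pt_lim_id.
- apply derivable_pt_lim_const.
Qed.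

Lemma differentiable_pt_lim_continuous_r (f : R -> R -> R) x y lx ly :
  differentiable_pt_lim f x y lx ly -> continuous (f x) y.
Proof.
intros H; apply (ex_derive_continuous (V := R_NormedModule)).
exists (lx * 0 + ly * 1); apply is_derive_Reals.
apply (derivable_pt_lim_comp_2d f (fun _ => x) (fun t => t)).
- exact H.
- apply derivable_pt_lim_const.
- apply derivable_pt_lim_id.
Qed.

Lemma RInt_near_const (f : R -> R) (a b k M : R) :
  a <= b -> ex_RInt f a b ->
  (forall t, a <= t <= b -> Rabs (f t - k) <= M) ->
  Rabs (RInt f a b - k * (b - a)) <= M * (b - a).
Proof.
intros ab If HM.
assert (Ik : ex_RInt (fun _ : R => k) a b) by apply ex_RInt_const.
replace (RInt f a b - k * (b - a)) with (RInt (fun t => f t - k) a b).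
- rewrite (Rmult_comm M); apply abs_RInt_le_const; [exact ab| |exact HM].
  exact (ex_RInt_minus f (fun _ => k) a b If Ik).
- etransitivity; [exact (RInt_minus f (fun _ => k) a b If Ik)|].
  rewrite RInt_const; unfold minus, plus, opp, scal; simpl; unfold mult; simpl; ring.
Qed.

Section Goursat.

Variables (P Q : R -> R -> R) (xl xr yl yr : R).
(** The shared [k] is both the y-derivative of [P] and the x-derivative of [Q]: the form is closed
    at every point, with no continuity of the partial derivatives assumed. *)
Hypothesis dPQ : forall x y, xl <= x <= xr -> yl <= y <= yr ->
  exists px k qy, differentiable_pt_lim P x y px k /\ differentiable_pt_lim Q x y k qy.

Let ex_RInt_P a b y : xl <= a -> a <= b -> b <= xr -> yl <= y <= yr -> ex_RInt (fun x => P x y) a b.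
Proof.
intros h1 h2 h3 hy; apply (ex_RInt_continuous (V := R_CompleteNormedModule)); intros z Hz.
rewrite Rmin_left, Rmax_right in Hz by lra.
destruct (dPQ z y) as (px & k & qy & H & _); [lra|lra|].
eapply differentiable_pt_lim_continuous_l, H.
Qed.

Let ex_RInt_Q c d x : yl <= c -> c <= d -> d <= yr -> xl <= x <= xr -> ex_RInt (Q x) c d.
Proof.
intros h1 h2 h3 hy; apply (ex_RInt_continuous (V := R_CompleteNormedModule)); intros z Hz.
rewrite Rmin_left, Rmax_right in Hz by lra.
destruct (dPQ x z) as (px & k & qy & _ & H); [lra|lra|].
eapply differentiable_pt_lim_continuous_r, H.
Qed.

Lemma circulation_split_l a m b c d :
  xl <= a -> a <= m -> m <= b -> b <= xr -> yl <= c -> c <= d -> d <= yr ->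
  circulation P Q a b c d = circulation P Q a m c d + circulation P Q m b c d.
Proof.
intros; unfold circulation.
rewrite <- (RInt_Chasles (fun x => P x c) a m b) by (apply ex_RInt_P; lra).
rewrite <- (RInt_Chasles (fun x => P x d) a m b) by (apply ex_RInt_P; lra).
unfold plus; simpl; ring.
Qed.

Lemma circulation_split_r a b c m d :
  xl <= a -> a <= b -> b <= xr -> yl <= c -> c <= m -> m <= d -> d <= yr ->
  circulation P Q a b c d = circulation P Q a b c m + circulation P Q a b m d.
Proof.
intros; unfold circulation.
rewrite <- (RInt_Chasles (Q a) c m d) by (apply ex_RInt_Q; lra).
rewrite <- (RInt_Chasles (Q b) c m d) by (apply ex_RInt_Q; lra).
unfold plus; simpl; ring.
Qed.

(** The affine parts of [P] and [Q] at [(x, y)] have zero circulation, since both cross coefficients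
    are [k]: the contributions [k (c - d) (b - a)] and [k (b - a) (d - c)] cancel. What remains on
    each of the four sides is at most [eps] times the larger side length times the length of that
    side. *)
Lemma circulation_small x y (eps : posreal) : xl <= x <= xr -> yl <= y <= yr ->
  exists delta : posreal, forall a b c d,
    xl <= a -> a <= x <= b -> b <= xr -> yl <= c -> c <= y <= d -> d <= yr ->
    b - a < delta -> d - c < delta ->
    Rabs (circulation P Q a b c d) <= 2 * eps * (Rmax (b - a) (d - c)) * ((b - a) + (d - c)).
Proof.
intros Hx Hy.
destruct (dPQ x y Hx Hy) as (px & k & qy & HP & HQ).
destruct (HP eps) as [d1 H1]; destruct (HQ eps) as [d2 H2].
exists (mkposreal (Rmin d1 d2) (Rmin_stable_in_posreal d1 d2)); simpl.
intros a b c d h1 h2 h3 h4 h5 h6 hab hcd.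
pose proof (Rmin_l d1 d2) as m1; pose proof (Rmin_r d1 d2) as m2.
set (W := Rmax (b - a) (d - c)).
assert (near : forall u v, a <= u <= b -> c <= v <= d ->
  Rmax (Rabs (u - x)) (Rabs (v - y)) <= W /\ Rabs (u - x) < Rmin d1 d2 /\ Rabs (v - y) < Rmin d1 d2).
{ intros u v hu hv.
  assert (A : Rabs (u - x) <= b - a) by (apply Rabs_le; lra).
  assert (B : Rabs (v - y) <= d - c) by (apply Rabs_le; lra).
  split; [|lra].
  apply Rmax_lub; eapply Rle_trans; try eassumption; [apply Rmax_l|apply Rmax_r]. }
assert (EP : forall u v, a <= u <= b -> c <= v <= d ->
  Rabs (P u v - P x y - (px * (u - x) + k * (v - y))) <= eps * W).
{ intros u v hu hv; destruct (near u v hu hv) as (n1 & n2 & n3).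
  eapply Rle_trans; [apply H1; lra|].
  apply Rmult_le_compat_l; [left; apply cond_pos|exact n1]. }
assert (EQ : forall u v, a <= u <= b -> c <= v <= d ->
  Rabs (Q u v - Q x y - (k * (u - x) + qy * (v - y))) <= eps * W).
{ intros u v hu hv; destruct (near u v hu hv) as (n1 & n2 & n3).
  eapply Rle_trans; [apply H2; lra|].
  apply Rmult_le_compat_l; [left; apply cond_pos|exact n1]. }
clear near H1 H2 HP HQ.
assert (IP : Rabs (RInt (fun u => P u c - P u d) a b - (k * (c - d)) * (b - a)) <= 2 * eps * W * (b - a)).
{ apply RInt_near_const; [lra| |].
  - apply (ex_RInt_minus (fun u => P u c) (fun u => P u d)); apply ex_RInt_P; lra.
  - intros t ht.
    assert (A := EP t c ht ltac:(lra)); assert (B := EP t d ht ltac:(lra)).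
    apply Rabs_le_between in A; apply Rabs_le_between in B; apply Rabs_le; lra. }
assert (IQ : Rabs (RInt (fun v => Q b v - Q a v) c d - (k * (b - a)) * (d - c)) <= 2 * eps * W * (d - c)).
{ apply RInt_near_const; [lra| |].
  - apply (ex_RInt_minus (Q b) (Q a)); apply ex_RInt_Q; lra.
  - intros t ht.
    assert (A := EQ a t ltac:(lra) ht); assert (B := EQ b t ltac:(lra) ht).
    apply Rabs_le_between in A; apply Rabs_le_between in B; apply Rabs_le; lra. }
assert (JP : RInt (fun u => P u c - P u d) a b = RInt (fun u => P u c) a b - RInt (fun u => P u d) a b).
{ apply (RInt_minus (fun u => P u c) (fun u => P u d)); apply ex_RInt_P; lra. }
assert (JQ : RInt (fun v => Q b v - Q a v) c d = RInt (Q b) c d - RInt (Q a) c d).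
{ apply (RInt_minus (Q b) (Q a)); apply ex_RInt_Q; lra. }
rewrite JP in IP; rewrite JQ in IQ.
unfold circulation.
apply Rabs_le_between in IP; apply Rabs_le_between in IQ; apply Rabs_le; lra.
Qed.

(* Goursat's bisection: some quarter carries a quarter of the circulation, whereas near
   the common point of the nested quarters the circulation is [o(area)]. *)
Lemma goursat : xl < xr -> yl < yr -> circulation P Q xl xr yl yr = 0.
Proof.
intros ab cd.
destruct (Req_dec (circulation P Q xl xr yl yr) 0) as [E|E]; [exact E|exfalso].
set (E0 := Rabs (circulation P Q xl xr yl yr)).
assert (E0pos : 0 < E0) by now apply Rabs_pos_lt.
set (w := fun n => (xr - xl) / 2 ^ n); set (h := fun n => (yr - yl) / 2 ^ n).
assert (p2 : forall n, 0 < 2 ^ n) by (intros n; apply pow_lt; lra).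
assert (wS : forall n, w n = 2 * w (S n)) by (intros n; unfold w; simpl; field; specialize (p2 n); lra).
assert (hS : forall n, h n = 2 * h (S n)) by (intros n; unfold h; simpl; field; specialize (p2 n); lra).
assert (wpos : forall n, 0 < w n) by (intros n; apply Rdiv_lt_0_compat; [lra|apply p2]).
assert (hpos : forall n, 0 < h n) by (intros n; apply Rdiv_lt_0_compat; [lra|apply p2]).
destruct (dependent_choice
  (fun n (z : R * R) => xl <= fst z /\ fst z + w n <= xr /\ yl <= snd z /\ snd z + h n <= yr /\
     E0 / 4 ^ n <= Rabs (circulation P Q (fst z) (fst z + w n) (snd z) (snd z + h n)))
  (fun n z z' => fst z <= fst z' /\ fst z' + w (S n) <= fst z + w n /\
     snd z <= snd z' /\ snd z' + h (S n) <= snd z + h n))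
  with (a0 := (xl, yl)) as (s & s0 & Hs).
- intros n [x y]; simpl; intros (h1 & h2 & h3 & h4 & h5).
  specialize (wS n); specialize (hS n).
  assert (wp := wpos (S n)); assert (hp := hpos (S n)).
  rewrite wS in *; rewrite hS in *.
  set (w' := w (S n)) in *; set (h' := h (S n)) in *.
  rewrite (circulation_split_l x (x + w')) in h5 by lra.
  rewrite (circulation_split_r x (x + w') y (y + h')) in h5 by lra.
  rewrite (circulation_split_r (x + w') (x + 2 * w') y (y + h')) in h5 by lra.
  replace (x + 2 * w') with ((x + w') + w') in h5 by ring.
  replace (y + 2 * h') with ((y + h') + h') in h5 by ring.
  replace (E0 / (4 * 4 ^ n)) with (E0 / 4 ^ n / 4) by (field; apply pow_nonzero; lra).
  set (e := E0 / 4 ^ n) in *.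
  match type of h5 with e <= Rabs (?A + ?B + (?C + ?D)) =>
    assert (T : e / 4 <= Rabs A \/ e / 4 <= Rabs B \/ e / 4 <= Rabs C \/ e / 4 <= Rabs D) end.
  { apply NNPP; intros N; apply not_or_and in N; destruct N as [N1 N].
    apply not_or_and in N; destruct N as [N2 N].
    apply not_or_and in N; destruct N as [N3 N4].
    apply Rnot_le_lt, Rabs_lt_between in N1; apply Rnot_le_lt, Rabs_lt_between in N2.
    apply Rnot_le_lt, Rabs_lt_between in N3; apply Rnot_le_lt, Rabs_lt_between in N4.
    apply Rle_not_lt in h5; apply h5, Rabs_lt_between; lra. }
  destruct T as [T|[T|[T|T]]];
    [exists (x, y)|exists (x, y + h')|exists (x + w', y)|exists (x + w', y + h')];
    simpl; repeat split; try lra; exact T.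
- simpl; replace (w O) with (xr - xl) by (unfold w; simpl; field).
  replace (h O) with (yr - yl) by (unfold h; simpl; field).
  replace (xl + (xr - xl)) with xr by ring; replace (yl + (yr - yl)) with yr by ring.
  fold E0; repeat split; try lra; simpl; lra.
- assert (pw0 : is_lim_seq (fun n => / 2 ^ n) 0).
  { apply (is_lim_seq_ext (fun n => (/ 2) ^ n)); [intros n; now rewrite pow_inv|].
    apply is_lim_seq_geom; rewrite Rabs_right; lra. }
  assert (lw : is_lim_seq w 0).
  { replace (Finite 0) with (Rbar_mult (xr - xl) 0) by (simpl; f_equal; ring).
    now apply (is_lim_seq_scal_l (fun n => / 2 ^ n)). }
  assert (lh : is_lim_seq h 0).
  { replace (Finite 0) with (Rbar_mult (yr - yl) 0) by (simpl; f_equal; ring).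
    now apply (is_lim_seq_scal_l (fun n => / 2 ^ n)). }
  assert (nested : forall (u l : nat -> R), is_lim_seq l 0 ->
    (forall n, u n <= u (S n)) -> (forall n, u (S n) + l (S n) <= u n + l n) ->
    exists x, forall n, u n <= x <= u n + l n).
  { intros u l Hl Hu Hv.
    destruct (ex_lim_seq_adj u (fun n => u n + l n) Hu Hv) as ((x & Hx) & (x' & Hx') & Ex).
    - apply (is_lim_seq_ext l); [intros n; ring|exact Hl].
    - rewrite (is_lim_seq_unique _ _ Hx), (is_lim_seq_unique _ _ Hx') in Ex.
      injection Ex as <-.
      exists x; intros n; split; [now apply is_lim_seq_incr_compare|].
      now apply (is_lim_seq_decr_compare (fun n => u n + l n)). }
  destruct (nested (fun n => fst (s n)) w lw) as [x Hx];
    [intros n; apply Hs|intros n; apply Hs|].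
  destruct (nested (fun n => snd (s n)) h lh) as [y Hy];
    [intros n; apply Hs|intros n; apply Hs|].
  assert (hx0 := Hx O); assert (hy0 := Hy O).
  destruct (Hs O) as [(h1 & h2 & h3 & h4 & _) _].
  set (W := Rmax (xr - xl) (yr - yl)); set (S0 := (xr - xl) + (yr - yl)).
  assert (Wpos : 0 < W) by (eapply Rlt_le_trans; [|apply Rmax_l]; lra).
  assert (Spos : 0 < S0) by (unfold S0; lra).
  (* Chosen so that the bound of [circulation_small] on the rectangle of stage [n] is half of the
     lower bound [E0 / 4 ^ n]. *)
  assert (eps0 : 0 < E0 / (4 * W * S0)).
  { apply Rdiv_lt_0_compat; [exact E0pos|]; repeat apply Rmult_lt_0_compat; lra. }
  destruct (circulation_small x y (mkposreal _ eps0)) as [delta Hd]; [lra|lra|].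
  assert (lw' := proj2 (is_lim_seq_spec _ _) lw delta).
  assert (lh' := proj2 (is_lim_seq_spec _ _) lh delta).
  destruct lw' as [N1 HN1]; destruct lh' as [N2 HN2].
  set (n := max N1 N2).
  specialize (HN1 n (Nat.le_max_l _ _)); specialize (HN2 n (Nat.le_max_r _ _)).
  rewrite Rminus_0_r in HN1, HN2; apply Rabs_lt_between in HN1; apply Rabs_lt_between in HN2.
  destruct (Hs n) as [(g1 & g2 & g3 & g4 & g5) _].
  specialize (Hd (fst (s n)) (fst (s n) + w n) (snd (s n)) (snd (s n) + h n)).
  assert (G := Rle_trans _ _ _ g5 (Hd g1 (Hx n) g2 g3 (Hy n) g4 ltac:(lra) ltac:(lra))).
  simpl in G.
  replace (fst (s n) + w n - fst (s n)) with (w n) in G by ring.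
  replace (snd (s n) + h n - snd (s n)) with (h n) in G by ring.
  replace (Rmax (w n) (h n)) with (W * / 2 ^ n) in G.
  2:{ unfold W; rewrite Rmax_mult by (left; apply Rinv_0_lt_compat, p2); reflexivity. }
  replace (w n + h n) with (S0 * / 2 ^ n) in G by (unfold S0, w, h; field; specialize (p2 n); lra).
  replace (4 ^ n) with (2 ^ n * 2 ^ n) in G by (rewrite <- Rpow_mult_distr; f_equal; ring).
  replace (2 * (E0 / (4 * W * S0)) * (W * / 2 ^ n) * (S0 * / 2 ^ n))
    with (E0 / (2 ^ n * 2 ^ n) / 2) in G by (field; specialize (p2 n); lra).
  assert (0 < E0 / (2 ^ n * 2 ^ n)); [|lra].
  apply Rdiv_lt_0_compat; [exact E0pos|apply Rmult_lt_0_compat; apply p2].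
Qed.

End Goursat.

(** * Bounded holomorphic functions of one variable *)

(** The little-o form avoids dividing by [w - z], and written with [Cmod] alone it does not choose
    between the two normed structures on [C]. *)
Definition is_cderive (f : C -> C) (z d : C) : Prop :=
  forall eps : posreal, exists delta : posreal, forall w : C,
    Cmod (w - z) < delta -> Cmod (f w - f z - d * (w - z)) <= eps * Cmod (w - z).

Lemma Cmod_Rabs_le (z : C) : Cmod z <= Rabs (Re z) + Rabs (Im z).
Proof.
destruct z as [x y]; unfold Cmod; simpl.
rewrite <- (sqrt_Rsqr (Rabs x + Rabs y)) by (generalize (Rabs_pos x), (Rabs_pos y); lra).
apply sqrt_le_1_alt; unfold Rsqr.
generalize (Rabs_pos x), (Rabs_pos y); intros hx hy.
replace (x * (x * 1)) with (Rabs x * Rabs x) by (rewrite <- Rabs_mult, Rabs_right; nra).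
replace (y * (y * 1)) with (Rabs y * Rabs y) by (rewrite <- Rabs_mult, Rabs_right; nra).
nra.
Qed.

Lemma im_le_Cmod (z : C) : Rabs (Im z) <= Cmod z.
Proof. eapply Rle_trans; [apply Rmax_r|apply Rmax_Cmod]. Qed.

(** These are the Cauchy-Riemann equations, read off from the real and imaginary parts of
    [d * (w - z)]. Halving [eps] and [delta] absorbs the factor 2 between [Cmod] and the maximum of
    the coordinates. *)
Lemma is_cderive_differentiable (f : C -> C) (x y : R) (d : C) :
  is_cderive f (x, y) d ->
  differentiable_pt_lim (fun u v => Re (f (u, v))) x y (Re d) (- Im d) /\
  differentiable_pt_lim (fun u v => Im (f (u, v))) x y (Im d) (Re d).
Proof.
intros H.
assert (K : forall eps : posreal, locally_2d (fun u v =>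
  Cmod (f (u, v) - f (x, y) - d * ((u, v) - (x, y))) <= eps * Rmax (Rabs (u - x)) (Rabs (v - y))) x y).
{ intros eps; destruct (H (pos_div_2 eps)) as [delta Hd].
  exists (pos_div_2 delta); intros u v hu hv; simpl in *.
  assert (B : Cmod ((u, v) - (x, y)) <= 2 * Rmax (Rabs (u - x)) (Rabs (v - y))).
  { eapply Rle_trans; [apply Cmod_Rabs_le|]; simpl.
    generalize (Rmax_l (Rabs (u - x)) (Rabs (v - y))), (Rmax_r (Rabs (u - x)) (Rabs (v - y))).
    unfold Rminus; lra. }
  assert (B' : Cmod ((u, v) - (x, y)) < delta).
  { eapply Rle_lt_trans; [apply B|].
    assert (Rmax (Rabs (u - x)) (Rabs (v - y)) < delta / 2) by now apply Rmax_lub_lt.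
    lra. }
  eapply Rle_trans; [apply Hd, B'|].
  generalize (cond_pos eps); intros; nra. }
split; intros eps; destruct (K eps) as [delta Hd]; exists delta; intros u v hu hv;
  (eapply Rle_trans; [|apply Hd; assumption]).
- eapply Rle_trans; [|apply re_le_Cmod].
  apply Req_le; f_equal; unfold Re, Im; simpl; ring.
- eapply Rle_trans; [|apply im_le_Cmod].
  apply Req_le; f_equal; unfold Re, Im; simpl; ring.
Qed.

(** * Differentiation rules in the plane and means over circles *)

Lemma differentiable_pt_lim_mult (f g : R -> R -> R) x y fx fy gx gy :
  differentiable_pt_lim f x y fx fy -> differentiable_pt_lim g x y gx gy ->
  differentiable_pt_lim (fun u v => f u v * g u v) x y
    (g x y * fx + f x y * gx) (g x y * fy + f x y * gy).
Proof.
intros Hf Hg.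
apply (differentiable_pt_lim_comp Rmult); [|exact Hf|exact Hg].
intros eps; exists eps; intros u v hu hv.
replace (_ - _ - _) with ((u - f x y) * (v - g x y)) by ring.
rewrite Rabs_mult, Rmult_comm.
apply Rmult_le_compat; try apply Rabs_pos; [now left|apply Rmax_l].
Qed.

Lemma differentiable_pt_lim_plus (f g : R -> R -> R) x y fx fy gx gy :
  differentiable_pt_lim f x y fx fy -> differentiable_pt_lim g x y gx gy ->
  differentiable_pt_lim (fun u v => f u v + g u v) x y (fx + gx) (fy + gy).
Proof.
intros Hf Hg.
replace (fx + gx) with (1 * fx + 1 * gx) by ring.
replace (fy + gy) with (1 * fy + 1 * gy) by ring.
apply (differentiable_pt_lim_comp Rplus); [|exact Hf|exact Hg].
intros eps; exists eps; intros u v hu hv.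
replace (_ - _ - _) with 0 by ring.
rewrite Rabs_R0; apply Rmult_le_pos; [left; apply cond_pos|].
eapply Rle_trans; [apply Rabs_pos|apply Rmax_l].
Qed.

Lemma differentiable_pt_lim_snd (f : R -> R) (x y l : R) :
  derivable_pt_lim f y l -> differentiable_pt_lim (fun _ v => f v) x y 0 l.
Proof.
intros H; apply (proj1 (filterdiff_differentiable_pt_lim (fun _ v => f v) x y 0 l)).
apply (filterdiff_ext_lin _ (fun u : R * R => scal (snd u) l)).
- apply (filterdiff_comp' snd f (x, y) snd (fun t => scal t l)).
  + apply filterdiff_linear, is_linear_snd.
  + apply is_derive_Reals, H.
- intros [a b]; simpl; unfold scal; simpl; unfold mult; simpl; ring.
Qed.

Lemma Cmod_polar (a t : R) : 0 <= a -> Cmod (a * cos t, a * sin t) = a.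
Proof.
intros ha; unfold Cmod; simpl.
replace (_ + _) with (a * a * ((sin t)² + (cos t)²)) by (unfold Rsqr; ring).
rewrite sin2_cos2, Rmult_1_r; now apply sqrt_square.
Qed.

(* The closed form [Re (f(z)/z dz / i)] in logarithmic polar coordinates [z = exp (s + i t)],
   periodic in [t]: the mean of [Re (f(z)/z)] over circles is independent of the radius. *)
Lemma Re_cderive_le (f : C -> C) (r K rho : R) (d0 : C) :
  f 0 = RtoC 0 -> is_cderive f 0 d0 ->
  (forall z, Cmod z < r -> exists d, is_cderive f z d) ->
  0 < rho < r -> (forall z, Cmod z = rho -> Cmod (f z) <= K) ->
  Re d0 <= K / rho.
Proof.
intros f0 Hd0 Hd Hrho HK.
set (X := fun s t => exp s * cos t); set (Y := fun s t => exp s * sin t).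
(* [Q] and [P] are the real and imaginary parts of [f(z)/z] at [z = exp (s + i t)], so [P ds + Q dt]
   is the imaginary part of [(f(z)/z) (ds + i dt)]. *)
set (Q := fun s t => exp (- s) * (Re (f (X s t, Y s t)) * cos t + Im (f (X s t, Y s t)) * sin t)).
set (P := fun s t => exp (- s) * (Im (f (X s t, Y s t)) * cos t + - Re (f (X s t, Y s t)) * sin t)).
assert (ex1 : forall s t, differentiable_pt_lim (fun s _ => exp s) s t (exp s) 0).
{ intros s t; apply differentiable_pt_lim_proj1_0, derivable_pt_lim_exp. }
assert (ex2 : forall s t, differentiable_pt_lim (fun s _ => exp (- s)) s t (- exp (- s)) 0).
{ intros s t; apply (differentiable_pt_lim_proj1_0 (fun s => exp (- s))).
  replace (- exp (- s)) with (exp (- s) * -1) by ring.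
  apply (derivable_pt_lim_comp Ropp exp); [|apply derivable_pt_lim_exp].
  apply derivable_pt_lim_opp, derivable_pt_lim_id. }
assert (dcos : forall s t, differentiable_pt_lim (fun _ t => cos t) s t 0 (- sin t)).
{ intros s t; apply differentiable_pt_lim_snd, derivable_pt_lim_cos. }
assert (dsin : forall s t, differentiable_pt_lim (fun _ t => sin t) s t 0 (cos t)).
{ intros s t; apply differentiable_pt_lim_snd, derivable_pt_lim_sin. }
assert (modz : forall s t, Cmod (X s t, Y s t) = exp s).
{ intros s t; apply Cmod_polar; left; apply exp_pos. }
assert (dPQ : forall s t, exp s < r -> exists px k qy,
  differentiable_pt_lim P s t px k /\ differentiable_pt_lim Q s t k qy).
{ intros s t hs.
  destruct (Hd (X s t, Y s t)) as [d D]; [now rewrite modz|].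
  destruct (is_cderive_differentiable _ _ _ _ D) as [Du Dv].
  assert (DX := differentiable_pt_lim_mult _ _ _ _ _ _ _ _ (ex1 s t) (dcos s t)).
  assert (DY := differentiable_pt_lim_mult _ _ _ _ _ _ _ _ (ex1 s t) (dsin s t)).
  assert (DU := differentiable_pt_lim_comp _ _ _ _ _ _ _ _ _ _ _ Du DX DY).
  assert (DV := differentiable_pt_lim_comp _ _ _ _ _ _ _ _ _ _ _ Dv DX DY).
  assert (DmU := differentiable_pt_lim_mult _ _ _ _ _ _ _ _
    (differentiable_pt_lim_proj1_0 (fun _ => -1) s t 0 (derivable_pt_lim_const (-1) s)) DU).
  assert (DQ := differentiable_pt_lim_mult _ _ _ _ _ _ _ _ (ex2 s t)
    (differentiable_pt_lim_plus _ _ _ _ _ _ _ _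
      (differentiable_pt_lim_mult _ _ _ _ _ _ _ _ DU (dcos s t))
      (differentiable_pt_lim_mult _ _ _ _ _ _ _ _ DV (dsin s t)))).
  assert (DP := differentiable_pt_lim_mult _ _ _ _ _ _ _ _ (ex2 s t)
    (differentiable_pt_lim_plus _ _ _ _ _ _ _ _
      (differentiable_pt_lim_mult _ _ _ _ _ _ _ _ DV (dcos s t))
      (differentiable_pt_lim_mult _ _ _ _ _ _ _ _ DmU (dsin s t)))).
  cbv beta in DP, DQ.
  (* [a'] is the s-derivative of [Q] and [b] the t-derivative of [P]; their equality is a
     Cauchy-Riemann relation for [f(z)/z], verified by [ring]. *)
  match type of DP with differentiable_pt_lim _ _ _ ?a ?b =>
  match type of DQ with differentiable_pt_lim _ _ _ ?a' ?b' =>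
    exists a, b, b'; split;
    [|replace b with a'; [exact DQ|unfold X, Y; ring]] end end.
  revert DP; apply differentiable_pt_lim_ext.
  exists (mkposreal 1 Rlt_0_1); intros u v _ _; unfold P, X, Y; ring. }
assert (mean : forall s1 s2, s1 < s2 -> exp s2 < r ->
  RInt (Q s1) 0 (2 * PI) = RInt (Q s2) 0 (2 * PI)).
{ intros s1 s2 h12 h2.
  assert (piP := PI_RGT_0).
  assert (G : circulation P Q s1 s2 0 (2 * PI) = 0).
  { apply goursat; [|lra|lra].
    intros x y hx hy; apply dPQ.
    eapply Rle_lt_trans; [|exact h2].
    destruct (proj2 hx) as [h| ->]; [left; now apply exp_increasing|lra]. }
  unfold circulation in G.
  (* The sides [t = 0] and [t = 2 PI] of the rectangle cancel by periodicity, leaving the integrals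
     over the two circles. *)
  rewrite (RInt_ext (fun x => P x 0) (fun x => P x (2 * PI))) in G; [lra|].
  intros x _; unfold P, X, Y.
  now rewrite cos_0, sin_0, cos_2PI, sin_2PI. }
assert (exQ : forall s, exp s < r -> ex_RInt (Q s) 0 (2 * PI)).
{ intros s hs; apply (ex_RInt_continuous (V := R_CompleteNormedModule)); intros t _.
  destruct (dPQ s t hs) as (px & k & qy & _ & H).
  eapply differentiable_pt_lim_continuous_r, H. }
assert (rot : forall (w : C) t, Rabs (Re w * cos t + Im w * sin t) <= Cmod w).
{ intros w t.
  replace (Re w * cos t + Im w * sin t) with (Re (w * (1 * cos (- t), 1 * sin (- t)))).
  - eapply Rle_trans; [apply re_le_Cmod|].
    rewrite Cmod_mult, Cmod_polar; lra.
  - rewrite cos_neg, sin_neg; unfold Re, Im; simpl; ring. }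
apply Rnot_lt_le; intros bad.
set (eta := (Re d0 - K / rho) / 2).
assert (eta0 : 0 < eta) by (unfold eta; lra).
destruct (Hd0 (mkposreal eta eta0)) as [delta Hdelta]; simpl in Hdelta.
assert (Hd1 : forall z : C, Cmod z < delta -> Cmod (f z - d0 * z) <= eta * Cmod z).
{ intros z Hz; specialize (Hdelta z); rewrite f0 in Hdelta.
  replace (z - 0)%C with z in Hdelta by ring.
  replace (f z - 0 - d0 * z)%C with (f z - d0 * z)%C in Hdelta by ring.
  now apply Hdelta. }
clear Hdelta; rename Hd1 into Hdelta.
(* On the circle of radius [rho] the mean is at most [K / rho] in modulus; the radius [m] is below
   [delta], so the mean there is within [eta] of [Re d0]. Since [eta] is half of the supposed gap,
   equality of the two means is contradictory. *)
set (s2 := ln rho); set (m := Rmin rho delta / 2); set (s1 := ln m).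
assert (m0 : 0 < m) by (unfold m; assert (0 < Rmin rho delta); [apply Rmin_glb_lt; [lra|apply cond_pos]|lra]).
assert (m1 : m < rho) by (unfold m in *; generalize (Rmin_l rho delta); lra).
assert (m2 : m < delta) by (unfold m in *; generalize (Rmin_r rho delta); lra).
assert (e1 : exp s1 = m) by now apply exp_ln.
assert (e2 : exp s2 = rho) by (apply exp_ln; lra).
assert (B2 : Rabs (RInt (Q s2) 0 (2 * PI) - 0 * (2 * PI - 0)) <= (K / rho) * (2 * PI - 0)).
{ apply RInt_near_const.
  - generalize PI_RGT_0; lra.
  - apply exQ; lra.
  - intros t _; rewrite Rminus_0_r; unfold Q.
    rewrite Rabs_mult, exp_Ropp, e2, Rabs_right by (apply Rle_ge; left; apply Rinv_0_lt_compat; lra).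
    unfold Rdiv; rewrite Rmult_comm; apply Rmult_le_compat_r; [left; apply Rinv_0_lt_compat; lra|].
    eapply Rle_trans; [apply rot|]; apply HK; now rewrite modz. }
assert (B1 : Rabs (RInt (Q s1) 0 (2 * PI) - Re d0 * (2 * PI - 0)) <= eta * (2 * PI - 0)).
{ apply RInt_near_const.
  - generalize PI_RGT_0; lra.
  - apply exQ; lra.
  - intros t _; unfold Q.
    set (z := (X s1 t, Y s1 t)).
    assert (Hz : Cmod z = m) by (unfold z; now rewrite modz).
    specialize (Hdelta z); rewrite Hz in Hdelta; specialize (Hdelta m2).
    replace (_ - Re d0) with (/ m * (Re (f z - d0 * z) * cos t + Im (f z - d0 * z) * sin t)).
    + rewrite Rabs_mult, Rabs_right by (apply Rle_ge; left; now apply Rinv_0_lt_compat).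
      apply (Rmult_le_reg_l m); [exact m0|].
      rewrite <- Rmult_assoc, Rinv_r, Rmult_1_l by lra.
      rewrite (Rmult_comm m); eapply Rle_trans; [apply rot|exact Hdelta].
    + rewrite exp_Ropp, e1; generalize (sin2_cos2 t); unfold Rsqr; intros sc.
      fold z.
      replace (Re (f z - d0 * z)) with (Re (f z) - (Re d0 * (m * cos t) - Im d0 * (m * sin t)))
        by (unfold z, X, Y; rewrite e1; unfold Re, Im; simpl; ring).
      replace (Im (f z - d0 * z)) with (Im (f z) - (Re d0 * (m * sin t) + Im d0 * (m * cos t)))
        by (unfold z, X, Y; rewrite e1; unfold Re, Im; simpl; ring).
      transitivity (/ m * (Re (f z) * cos t + Im (f z) * sin t)
        - (/ m * m) * (Re d0 * (sin t * sin t + cos t * cos t))); [ring|].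
      rewrite sc, Rinv_l by lra; ring. }
rewrite (mean s1 s2) in B1; [|apply ln_increasing; lra|lra].
apply Rabs_le_between in B1; apply Rabs_le_between in B2.
assert (piP := PI_RGT_0).
assert (E : (Re d0 - eta) * (2 * PI) <= K / rho * (2 * PI)) by lra.
apply Rmult_le_reg_r in E; [|lra].
unfold eta in *; lra.
Qed.

(** * Rules for complex derivatives, the Cauchy estimate and the Lipschitz bound *)

Lemma is_cderive_shift (f : C -> C) (w z d : C) :
  is_cderive f (w + z)%C d -> is_cderive (fun z => f (w + z)%C) z d.
Proof.
intros H eps; destruct (H eps) as [delta Hd]; exists delta; intros v hv.
specialize (Hd (w + v)%C).
replace (w + v - (w + z))%C with (v - z)%C in Hd by ring.
now apply Hd.
Qed.

Lemma is_cderive_minus (f g : C -> C) (z df dg : C) :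
  is_cderive f z df -> is_cderive g z dg ->
  is_cderive (fun z => f z - g z)%C z (df - dg)%C.
Proof.
intros Hf Hg eps.
destruct (Hf (pos_div_2 eps)) as [d1 H1], (Hg (pos_div_2 eps)) as [d2 H2].
exists (mkposreal _ (Rmin_stable_in_posreal d1 d2)); simpl; intros v hv.
specialize (H1 v (Rlt_le_trans _ _ _ hv (Rmin_l _ _))).
specialize (H2 v (Rlt_le_trans _ _ _ hv (Rmin_r _ _))).
simpl in H1, H2.
replace (_ - _ - _)%C with ((f v - f z - df * (v - z)) + - (g v - g z - dg * (v - z)))%C by ring.
eapply Rle_trans; [apply Cmod_triangle|]; rewrite Cmod_opp; lra.
Qed.

Lemma is_cderive_const (c z : C) : is_cderive (fun _ => c) z (RtoC 0).
Proof.
intros eps; exists eps; intros v _.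
replace (_ - _ - _)%C with (RtoC 0) by ring.
rewrite Cmod_0; apply Rmult_le_pos; [left; apply cond_pos|apply Cmod_ge_0].
Qed.

Lemma is_cderive_scal (f : C -> C) (c z d : C) :
  is_cderive f z d -> is_cderive (fun z => c * f z)%C z (c * d)%C.
Proof.
intros H eps.
assert (hc := Cmod_ge_0 c).
assert (e0 : 0 < eps / (Cmod c + 1)) by (apply Rdiv_lt_0_compat; [apply cond_pos|lra]).
destruct (H (mkposreal _ e0)) as [delta Hd]; exists delta; intros v hv.
specialize (Hd v hv); simpl in Hd.
replace (_ - _ - _)%C with (c * (f v - f z - d * (v - z)))%C by ring.
rewrite Cmod_mult.
apply Rle_trans with ((Cmod c + 1) * (eps / (Cmod c + 1) * Cmod (v - z))).
- apply Rmult_le_compat; try apply Cmod_ge_0; lra.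
- apply Req_le; field; lra.
Qed.

Section OneVariable.

Variables (f : C -> C) (r M : R).
Hypothesis r0 : 0 < r.
Hypothesis df : forall z, Cmod z < r -> exists d, is_cderive f z d.
Hypothesis fM : forall z, Cmod z < r -> Cmod (f z) <= M.

(** Multiplying by [Cconj d] turns the derivative into the real number [Cmod d ^ 2], so a bound on
    real parts is enough. The 4 comes from [Cmod (f z - f 0) <= 2 * M] on the circle of radius
    [r / 2]. *)
Lemma cauchy_estimate d : is_cderive f 0 d -> Cmod d <= 4 * M / r.
Proof.
intros Hd.
destruct (Req_dec (Cmod d) 0) as [E|E].
{ rewrite E; apply Rdiv_le_0_compat; [|exact r0].
  assert (0 <= M); [|lra].
  apply Rle_trans with (Cmod (f 0)); [apply Cmod_ge_0|apply fM; rewrite Cmod_0; lra]. }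
assert (hd := Cmod_ge_0 d).
assert (H : Re (Cconj d * d) <= (Cmod d * (2 * M)) / (r / 2)).
{ apply (Re_cderive_le (fun z => Cconj d * (f z - f 0))%C r).
  - ring.
  - apply is_cderive_scal.
    replace d with (d - 0)%C at 1 by ring.
    apply (is_cderive_minus f (fun _ => f 0)); [exact Hd|apply is_cderive_const].
  - intros z hz; destruct (df z hz) as [d' Hd'].
    exists (Cconj d * (d' - 0))%C; apply is_cderive_scal.
    apply (is_cderive_minus f (fun _ => f 0)); [exact Hd'|apply is_cderive_const].
  - lra.
  - intros z hz; rewrite Cmod_mult, Cmod_conj.
    apply Rmult_le_compat_l; [exact hd|].
    unfold Cminus; eapply Rle_trans; [apply Cmod_triangle|]; rewrite Cmod_opp.
    assert (A := fM z ltac:(lra)); assert (B := fM 0 ltac:(rewrite Cmod_0; lra)); lra. }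
replace (Re (Cconj d * d)) with (Cmod d * Cmod d) in H.
- apply (Rmult_le_reg_l (Cmod d)); [lra|].
  eapply Rle_trans; [exact H|]; apply Req_le; field; lra.
- rewrite Cmult_comm.
  replace (Cmod d * Cmod d) with (Cmod d ^ 2) by ring.
  rewrite <- (Cmod2_conj d); simpl; ring.
Qed.

End OneVariable.

(** The mean value theorem is one for real functions, so the real and imaginary parts along the
    segment are treated separately; this costs the factor 2. *)
Lemma mean_value_C (f : C -> C) (z : C) (D : R) :
  (forall t, 0 <= t <= 1 -> exists d, is_cderive f (t * z)%C d /\ Cmod d <= D) ->
  Cmod (f z - f 0) <= 2 * D * Cmod z.
Proof.
intros H.
assert (exd : forall t, exists d, 0 <= t <= 1 -> is_cderive f (t * z)%C d /\ Cmod d <= D).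
{ intros t; destruct (classic (0 <= t <= 1)) as [h|h].
  - destruct (H t h) as [d Hd]; now exists d.
  - exists (RtoC 0); tauto. }
apply choice in exd; destruct exd as [d Hd].
destruct z as [x y] eqn:Ez; rewrite <- Ez in *.
assert (tz : forall t : R, (t * z)%C = (t * x, t * y)).
{ intros t; rewrite Ez; unfold Cmult; simpl; f_equal; ring. }
assert (lin : forall t k, derivable_pt_lim (fun t => t * k) t k).
{ intros t k; apply is_derive_Reals; auto_derive; [exact I|ring]. }
(* Both derivatives have the form [Re (k * (d t * z))], with [k = 1] for the real part and
   [k = - Ci] for the imaginary part. *)
assert (bound : forall t, 0 <= t <= 1 -> forall k : C, Cmod k = 1 ->
  Rabs (Re (k * (d t * z))) <= D * Cmod z).
{ intros t ht k hk; eapply Rle_trans; [apply re_le_Cmod|].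
  rewrite !Cmod_mult, hk, Rmult_1_l; apply Rmult_le_compat_r; [apply Cmod_ge_0|now apply Hd]. }
assert (var : forall h dh : R -> R, (forall t, 0 <= t <= 1 -> is_derive h t (dh t)) ->
  (forall t, 0 <= t <= 1 -> Rabs (dh t) <= D * Cmod z) -> Rabs (h 1 - h 0) <= D * Cmod z).
{ intros h dh H1 H2.
  destruct (MVT_gen h 0 1 dh) as (c & hc & E).
  - intros t; rewrite Rmin_left, Rmax_right by lra; intros ht; apply H1; lra.
  - intros t; rewrite Rmin_left, Rmax_right by lra; intros ht.
    apply derivable_continuous_pt; exists (dh t); apply is_derive_Reals, H1, ht.
  - rewrite Rmin_left, Rmax_right in hc by lra.
    rewrite E, Rminus_0_r, Rmult_1_r; now apply H2. }
eapply Rle_trans; [apply Cmod_Rabs_le|].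
replace (f z) with (f (1 * x, 1 * y)) by (rewrite Ez; f_equal; f_equal; ring).
replace (f (RtoC 0)) with (f (0 * x, 0 * y)) by (f_equal; unfold RtoC; f_equal; ring).
replace (2 * D * Cmod z) with (D * Cmod z + D * Cmod z) by ring.
apply Rplus_le_compat.
- replace (Re (f (1 * x, 1 * y) - f (0 * x, 0 * y)))
    with (Re (f (1 * x, 1 * y)) - Re (f (0 * x, 0 * y))) by reflexivity.
  apply (var (fun t => Re (f (t * x, t * y))) (fun t => Re (1 * (d t * z)))).
  + intros t ht; destruct (Hd t ht) as [D1 _]; rewrite tz in D1.
    destruct (is_cderive_differentiable _ _ _ _ D1) as [Du _].
    assert (E := derivable_pt_lim_comp_2d _ _ _ _ _ _ _ _ Du (lin t x) (lin t y)).
    apply is_derive_Reals; simpl in E.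
    replace (Re (1 * (d t * z))) with (Re (d t) * x + - Im (d t) * y); [exact E|].
    rewrite Ez; unfold Re, Im; simpl; ring.
  + intros t ht; apply bound; [exact ht|apply Cmod_1].
- replace (Im (f (1 * x, 1 * y) - f (0 * x, 0 * y)))
    with (Im (f (1 * x, 1 * y)) - Im (f (0 * x, 0 * y))) by reflexivity.
  apply (var (fun t => Im (f (t * x, t * y))) (fun t => Re (- Ci * (d t * z)))).
  + intros t ht; destruct (Hd t ht) as [D1 _]; rewrite tz in D1.
    destruct (is_cderive_differentiable _ _ _ _ D1) as [_ Dv].
    assert (E := derivable_pt_lim_comp_2d _ _ _ _ _ _ _ _ Dv (lin t x) (lin t y)).
    apply is_derive_Reals; simpl in E.
    replace (Re (- Ci * (d t * z))) with (Im (d t) * x + Re (d t) * y); [exact E|].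
    rewrite Ez; unfold Re, Im; simpl; ring.
  + intros t ht; apply bound; [exact ht|rewrite Cmod_opp; apply Cmod_Ci].
Qed.

(** The disc of radius [r / 2] around any point of the segment from [w] to [w + z] stays in the
    domain, so the derivative there is at most [4 * M / (r / 2)]; the factor 2 of [mean_value_C]
    makes it 16. *)
Lemma bounded_holomorphic_lipschitz (f : C -> C) (r M : R) (w z : C) :
  0 < r ->
  (forall z, Cmod (z - w) < r -> exists d, is_cderive f z d) ->
  (forall z, Cmod (z - w) < r -> Cmod (f z) <= M) ->
  Cmod z <= r / 2 -> Cmod (f (w + z)%C - f w) <= 16 * M / r * Cmod z.
Proof.
intros r0 df fM hz.
replace (f w) with (f (w + 0)%C) by (f_equal; ring).
replace (16 * M / r) with (2 * (4 * M / (r / 2))) by (field; lra).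
apply (mean_value_C (fun z => f (w + z)%C)); intros t ht.
assert (near : forall v, Cmod v < r / 2 -> Cmod (w + t * z + v - w) < r).
{ intros v hv; replace (w + t * z + v - w)%C with (t * z + v)%C by ring.
  eapply Rle_lt_trans; [apply Cmod_triangle|].
  rewrite Cmod_mult, Cmod_R, Rabs_right by lra.
  assert (t * Cmod z <= 1 * Cmod z) by (apply Rmult_le_compat_r; [apply Cmod_ge_0|lra]); lra. }
destruct (df (w + t * z)%C) as [d Hd].
{ replace (w + t * z)%C with (w + t * z + 0)%C by ring; apply near; rewrite Cmod_0; lra. }
exists d; split; [now apply is_cderive_shift|].
apply (cauchy_estimate (fun v => f (w + t * z + v)%C)); [lra| | |].
- intros v hv; destruct (df (w + t * z + v)%C) as [d' Hd']; [now apply near|].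
  exists d'; now apply (is_cderive_shift f (w + t * z)%C).
- intros v hv; now apply fM, near.
- apply (is_cderive_shift f (w + t * z)%C).
  now replace (w + t * z + 0)%C with (w + t * z)%C by ring.
Qed.

(** * Second-order Taylor estimate *)

Section Taylor.

Variables (f : C -> C) (r M : R).
Hypothesis r0 : 0 < r.
Hypothesis df : forall z, Cmod z < r -> exists d, is_cderive f z d.
Hypothesis fM : forall z, Cmod z < r -> Cmod (f z) <= M.

(* The increment [z |-> f (z + h) - f z] is holomorphic and [O(h)], so its own Lipschitz
   bound controls the second difference without using that [f'] is differentiable. *)
Lemma second_difference_le (h z : C) : Cmod h <= r / 4 -> Cmod z <= r / 4 ->
  Cmod ((f (z + h)%C - f z) - (f h - f 0)) <= 1024 * M / r ^ 2 * Cmod h * Cmod z.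
Proof.
intros hh hz.
assert (dom : forall v, Cmod v < r / 2 -> Cmod (v + h) < r).
{ intros v hv; eapply Rle_lt_trans; [apply Cmod_triangle|]; lra. }
(* On the disc of radius [r / 2] the increment is at most [16 * M / (r / 2) * Cmod h]. A second use
   of the Lipschitz bound on that disc gives the constant [16 * 32 * 2 = 1024]. *)
assert (L := bounded_holomorphic_lipschitz (fun z => f (h + z) - f z)%C (r / 2)
  (32 * M / r * Cmod h) 0 z).
cbv beta in L.
replace (0 + z)%C with z in L by ring.
replace (h + 0)%C with h in L by ring.
replace (z + h)%C with (h + z)%C by ring.
eapply Rle_trans; [apply L|].
- lra.
- intros v hv; replace (v - 0)%C with v in hv by ring.
  destruct (df (h + v)%C) as [d1 D1]; [rewrite Cplus_comm; now apply dom|].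
  destruct (df v) as [d2 D2]; [lra|].
  exists (d1 - d2)%C.
  apply (is_cderive_minus (fun v => f (h + v)%C) f); [now apply is_cderive_shift|exact D2].
- intros v hv; replace (v - 0)%C with v in hv by ring.
  rewrite (Cplus_comm h v).
  replace (32 * M / r) with (16 * M / (r / 2)) by (field; lra).
  assert (near : forall u, Cmod (u - v) < r / 2 -> Cmod u < r).
  { intros u hu; replace u with (v + (u - v))%C by ring.
    eapply Rle_lt_trans; [apply Cmod_triangle|]; lra. }
  apply bounded_holomorphic_lipschitz; [lra| | |lra].
  + intros u hu; apply df, near, hu.
  + intros u hu; apply fM, near, hu.
- lra.
- apply Req_le; field; lra.
Qed.

(** Cut the segment from 0 to [z] into [n] steps [h = z / n]. By [second_difference_le] every
    increment of [f] is close to the increment [f h - f 0], and the errors add up to at most [K]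
    whatever [n] is. As [n] grows, [n (f h - f 0)] tends to [d z] by differentiability at 0
    alone. *)
Lemma taylor_le (d z : C) : is_cderive f 0 d -> Cmod z <= r / 4 ->
  Cmod (f z - f 0 - d * z) <= 1024 * M / r ^ 2 * Cmod z ^ 2.
Proof.
intros Hd hz.
set (K := 1024 * M / r ^ 2 * Cmod z ^ 2).
assert (zp := Cmod_ge_0 z).
assert (M0 : 0 <= M).
{ apply Rle_trans with (Cmod (f 0)); [apply Cmod_ge_0|apply fM; rewrite Cmod_0; lra]. }
assert (K0 : 0 <= 1024 * M / r ^ 2) by (apply Rdiv_le_0_compat; [lra|apply pow_lt, r0]).
(* The bound is quadratic in [k / n] because passing from [k] to [k + 1] adds an error proportional
   to [k / n ^ 2]. *)
assert (tel : forall n k : nat, (0 < n)%nat -> (k <= n)%nat ->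
  Cmod (f ((INR k / INR n)%R * z)%C - f 0 - INR k * (f ((1 / INR n)%R * z)%C - f 0))
    <= K * (INR k / INR n) ^ 2).
{ intros n k hn.
  assert (n0 : 0 < INR n) by now apply lt_0_INR.
  set (h := ((1 / INR n)%R * z)%C).
  assert (modt : forall t, 0 <= t -> Cmod (t * z) = t * Cmod z).
  { intros t ht; rewrite Cmod_mult, Cmod_R, Rabs_right; lra. }
  assert (hmod : Cmod h = 1 / INR n * Cmod z).
  { apply modt; apply Rdiv_le_0_compat; lra. }
  assert (n1 : 1 / INR n <= 1).
  { apply Rle_div_l; [exact n0|]; rewrite Rmult_1_l; now apply (le_INR 1). }
  induction k as [|k IH]; intros hk.
  - simpl INR. replace ((0 / INR n)%R * z)%C with (RtoC 0).
    + replace (_ - _ - _)%C with (RtoC 0) by ring.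
      rewrite Cmod_0; apply Req_le; field; lra.
    + unfold Rdiv; rewrite Rmult_0_l; ring.
  - specialize (IH ltac:(lia)).
    assert (kn : INR k / INR n <= 1).
    { apply Rle_div_l; [exact n0|]; rewrite Rmult_1_l; apply le_INR; lia. }
    assert (k0 : 0 <= INR k / INR n) by (apply Rdiv_le_0_compat; [apply pos_INR|exact n0]).
    assert (S2 := second_difference_le h ((INR k / INR n)%R * z)%C).
    rewrite hmod, (modt _ k0) in S2.
    specialize (S2 ltac:(nra) ltac:(nra)).
    replace ((INR k / INR n)%R * z + h)%C with ((INR (S k) / INR n)%R * z)%C in S2.
    2:{ unfold h; rewrite S_INR.
        replace ((INR k + 1) / INR n) with (INR k / INR n + 1 / INR n) by (field; lra).
        rewrite RtoC_plus; ring. }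
    set (a := f ((INR k / INR n)%R * z)%C) in *; set (b := f ((INR (S k) / INR n)%R * z)%C) in *.
    rewrite S_INR, RtoC_plus.
    replace (b - f 0 - (INR k + 1) * (f h - f 0))%C
      with ((a - f 0 - INR k * (f h - f 0)) + (b - a - (f h - f 0)))%C by ring.
    eapply Rle_trans; [apply Cmod_triangle|].
    eapply Rle_trans; [apply Rplus_le_compat; [exact IH|exact S2]|].
    unfold K.
    apply Rle_trans with (1024 * M / r ^ 2 * (Cmod z ^ 2 * ((INR k / INR n) ^ 2 + 1 / INR n * (INR k / INR n)))).
    + apply Req_le; ring.
    + rewrite Rmult_assoc; apply Rmult_le_compat_l; [exact K0|].
      apply Rmult_le_compat_l; [apply pow2_ge_0|].
      replace ((INR k + 1) / INR n) with (INR k / INR n + 1 / INR n) by (field; lra).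
      assert (0 <= 1 / INR n) by (apply Rdiv_le_0_compat; lra).
      nra. }
apply Rnot_lt_le; intros bad.
set (e := Cmod (f z - f 0 - d * z) - K) in *.
assert (e0 : 0 < e / (Cmod z + 1)) by (apply Rdiv_lt_0_compat; unfold e; lra).
destruct (Hd (mkposreal _ e0)) as [delta Hdelta]; simpl in Hdelta.
(* [n] is large enough for [h = z / N] to lie within [delta] of 0; the error of the differential at
   [h], multiplied by [N], is then below the supposed excess [e]. *)
destruct (nfloor_ex ((Cmod z + 1) / delta)) as [n [_ Hn]].
{ apply Rdiv_le_0_compat; [lra|apply cond_pos]. }
assert (n0 : 0 < INR (S n)) by (apply lt_0_INR; lia).
rewrite <- S_INR in Hn.
specialize (tel (S n) (S n) ltac:(lia) ltac:(lia)).
set (N := INR (S n)) in *.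
replace (N / N) with 1 in tel by (field; lra).
replace (1 * z)%C with z in tel by ring.
set (h := ((1 / N)%R * z)%C) in *.
assert (hmod : Cmod h = 1 / N * Cmod z).
{ unfold h; rewrite Cmod_mult, Cmod_R, Rabs_right; [reflexivity|].
  apply Rle_ge, Rdiv_le_0_compat; lra. }
specialize (Hdelta h); replace (h - 0)%C with h in Hdelta by ring.
assert (hd : Cmod h < delta).
{ rewrite hmod; apply Rlt_div_l in Hn; [|apply cond_pos].
  apply (Rmult_lt_reg_l N); [exact n0|].
  replace (N * (1 / N * Cmod z)) with (Cmod z) by (field; lra); lra. }
specialize (Hdelta hd); rewrite hmod in Hdelta.
assert (E : (f z - f 0 - d * z)%C =
  ((f z - f 0 - N * (f h - f 0)) + N * (f h - f 0 - d * h))%C).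
{ replace (N * (f h - f 0 - d * h))%C with (N * (f h - f 0) - (N * (1 / N)%R) * (d * z))%C
    by (unfold h; ring).
  rewrite <- RtoC_mult; replace (N * (1 / N))%R with 1%R by (field; lra); ring. }
assert (T := Cmod_triangle (f z - f 0 - N * (f h - f 0)) (N * (f h - f 0 - d * h))).
rewrite <- E, Cmod_mult, Cmod_R, Rabs_right in T by lra.
assert (U : N * Cmod (f h - f 0 - d * h) <= e / (Cmod z + 1) * Cmod z).
{ eapply Rle_trans; [apply Rmult_le_compat_l; [lra|exact Hdelta]|].
  apply Req_le; field; lra. }
assert (V : e / (Cmod z + 1) * Cmod z < e).
{ apply (Rmult_lt_reg_r (Cmod z + 1)); [lra|].
  replace (e / (Cmod z + 1) * Cmod z * (Cmod z + 1)) with (e * Cmod z) by (field; lra).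
  assert (0 < e) by (unfold e; lra); nra. }
unfold e in *; lra.
Qed.

End Taylor.

(** * Holomorphic functions on a normed space *)

Lemma filterlim_eventually_norm {K : AbsRing} {V : NormedModule K} (u : nat -> V) (l : V) :
  filterlim u eventually (locally l) <->
  forall eps : R, 0 < eps -> exists N : nat, forall n, (N <= n)%nat -> norm (minus (u n) l) < eps.
Proof.
split; intros H.
- intros eps he.
  destruct (H (ball_norm l (mkposreal _ he))) as [N HN].
  + apply locally_le_locally_norm, locally_norm_ball_norm.
  + exists N; exact HN.
- intros P HP; apply locally_norm_le_locally in HP; destruct HP as [eps HP].
  destruct (H eps (cond_pos eps)) as [N HN].
  exists N; intros n hn; apply HP, HN, hn.
Qed.

Lemma filterlim_norm_le {K : AbsRing} {V : NormedModule K} (u : nat -> V) (l : V) (B : R) :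
  filterlim u eventually (locally l) -> (forall n, norm (u n) <= B) -> norm l <= B.
Proof.
intros Hu HB; apply Rnot_lt_le; intros h.
destruct (proj1 (filterlim_eventually_norm u l) Hu (norm l - B)) as [N HN]; [lra|].
specialize (HN N (Nat.le_refl _)).
assert (T := norm_triangle_inv (u N) l); apply Rabs_le_between in T.
specialize (HB N); lra.
Qed.

Lemma filterlim_seq_plus {K : AbsRing} {V : NormedModule K} (u v : nat -> V) (a b : V) :
  filterlim u eventually (locally a) -> filterlim v eventually (locally b) ->
  filterlim (fun n => plus (u n) (v n)) eventually (locally (plus a b)).
Proof. intros Hu Hv; exact (filterlim_comp_2 _ _ _ Hu Hv (filterlim_plus a b)). Qed.

Lemma filterlim_seq_scal {K : AbsRing} {V : NormedModule K} (k : K) (u : nat -> V) (a : V) :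
  filterlim u eventually (locally a) ->
  filterlim (fun n => scal k (u n)) eventually (locally (scal k a)).
Proof. intros Hu; exact (filterlim_comp _ _ _ _ _ _ _ _ Hu (filterlim_scal_r k a)). Qed.

Lemma filterlim_seq_minus {K : AbsRing} {V : NormedModule K} (u v : nat -> V) (a b : V) :
  filterlim u eventually (locally a) -> filterlim v eventually (locally b) ->
  filterlim (fun n => minus (u n) (v n)) eventually (locally (minus a b)).
Proof.
intros Hu Hv; apply filterlim_seq_plus; [exact Hu|].
exact (filterlim_comp _ _ _ _ _ _ _ _ Hv (filterlim_opp b)).
Qed.

(** Completeness as a predicate on a plain [NormedModule], so that it can be a hypothesis in the
    sections below and is also available for [C]. *)
Definition sequentially_complete {K : AbsRing} (V : NormedModule K) : Prop :=
  forall u : nat -> V,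
    (forall eps : R, 0 < eps -> exists N : nat, forall n m, (N <= n)%nat -> (N <= m)%nat ->
       norm (minus (u n) (u m)) < eps) ->
    exists l : V, filterlim u eventually (locally l).

Lemma CompleteNormedModule_sequentially_complete {K : AbsRing} (V : CompleteNormedModule K) :
  sequentially_complete V.
Proof.
intros u H.
apply (proj1 (filterlim_locally_cauchy (U := V) (F := eventually) u)).
intros eps; destruct (H eps (cond_pos eps)) as [N HN].
exists (fun n => (N <= n)%nat); split; [now exists N|].
intros n m hn hm; apply (norm_compat1 (V := V)), HN; assumption.
Qed.

(** * Differentials in epsilon-delta form and restriction to complex lines *)

Lemma filterdiff_eps {V : NormedModule C_AbsRing} (f : V -> C) (x : V) (l : V -> C) :
  filterdiff f (locally x) l -> forall eps : posreal, exists delta : posreal, forall y : V,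
    norm (minus y x) < delta -> Cmod (f y - f x - l (minus y x)) <= eps * norm (minus y x).
Proof.
intros [_ H] eps.
specialize (H x (fun P HP => HP) eps).
apply locally_norm_le_locally in H; destruct H as [delta H].
exists delta; exact H.
Qed.

Lemma eps_filterdiff {V : NormedModule C_AbsRing} (f : V -> C) (x : V) (l : V -> C) :
  is_linear l ->
  (forall eps : posreal, exists delta : posreal, forall y : V,
    norm (minus y x) < delta -> Cmod (f y - f x - l (minus y x)) <= eps * norm (minus y x)) ->
  filterdiff f (locally x) l.
Proof.
intros Hl H; split; [exact Hl|].
intros x' hx' eps.
apply is_filter_lim_locally_unique in hx'; subst x'.
destruct (H eps) as [delta Hd].
apply locally_le_locally_norm; exists delta; exact Hd.
Qed.

Lemma norm_scal_le {V : NormedModule C_AbsRing} (k : C) (x : V) :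
  norm (scal k x) <= Cmod k * norm x.
Proof. exact (norm_scal k x). Qed.

Lemma minus_plus_l {K : AbsRing} {V : NormedModule K} (x h : V) : minus (plus x h) x = h.
Proof.
transitivity (plus h (minus x x)).
- unfold minus; rewrite (plus_comm x h); symmetry; apply plus_assoc.
- rewrite minus_eq_zero; apply plus_zero_r.
Qed.
Lemma plus_minus_r {K : AbsRing} {V : NormedModule K} (x y : V) : plus x (minus y x) = y.
Proof.
transitivity (plus y (minus x x)).
- unfold minus. rewrite plus_assoc, (plus_comm x y). symmetry; apply plus_assoc.
- rewrite minus_eq_zero; apply plus_zero_r.
Qed.
Lemma minus_plus_plus {K : AbsRing} {V : NormedModule K} (x a b : V) :
  minus (plus x a) (plus x b) = minus a b.
Proof.
rewrite (minus_trans x (plus x a)), minus_plus_l. unfold minus at 2.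
rewrite <- (opp_minus (plus x b)), minus_plus_l. reflexivity.
Qed.

Lemma norm_minus_self {K : AbsRing} {V : NormedModule K} (x : V) : norm (minus x x) = 0.
Proof. etransitivity; [apply f_equal; exact (minus_eq_zero x)|apply norm_zero]. Qed.

Lemma is_cderive_line {V : NormedModule C_AbsRing} (F : V -> C) (x h : V) (z : C) (l : V -> C) :
  filterdiff F (locally (plus x (scal z h))) l ->
  is_cderive (fun z => F (plus x (scal z h))) z (l h).
Proof.
intros H eps.
assert (hn := norm_ge_0 h).
assert (lin := proj1 H).
assert (e0 : 0 < eps / (norm h + 1)) by (apply Rdiv_lt_0_compat; [apply cond_pos|lra]).
destruct (filterdiff_eps _ _ _ H (mkposreal _ e0)) as [delta Hd]; simpl in Hd.
assert (d0 : 0 < delta / (norm h + 1)) by (apply Rdiv_lt_0_compat; [apply cond_pos|lra]).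
exists (mkposreal _ d0); simpl; intros w hw.
assert (E : minus (plus x (scal w h)) (plus x (scal z h)) = scal (w - z)%C h).
{ rewrite minus_plus_plus; symmetry; exact (scal_minus_distr_r (w : C_Ring) z h). }
specialize (Hd (plus x (scal w h))); rewrite E in Hd.
assert (N := norm_scal_le (w - z)%C h).
assert (cw := Cmod_ge_0 (w - z)).
rewrite (linear_scal _ lin) in Hd.
replace (l h * (w - z))%C with (scal (w - z)%C (l h)) by (apply Cmult_comm).
apply Rlt_div_r in hw; [|lra].
eapply Rle_trans; [apply Hd; nra|].
apply Rle_trans with (eps / (norm h + 1) * (Cmod (w - z) * (norm h + 1))).
- apply Rmult_le_compat_l; [lra|nra].
- apply Req_le; field; lra.
Qed.

Section Holomorphic.

Variables (V : NormedModule C_AbsRing) (F : V -> C) (x h : V) (rho M : R).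
Hypothesis rho0 : 0 < rho.
Hypothesis dF : forall y : V, norm (minus y x) < rho -> ex_filterdiff F (locally y).
Hypothesis FM : forall y : V, norm (minus y x) < rho -> Cmod (F y) <= M.

Let line_in (z : C) : 0 < norm h -> Cmod z < rho / norm h -> norm (minus (plus x (scal z h)) x) < rho.
Proof.
intros h0 hz; rewrite minus_plus_l.
eapply Rle_lt_trans; [apply norm_scal_le|]; now apply Rlt_div_r.
Qed.

Let line_holo (z : C) : 0 < norm h -> Cmod z < rho / norm h ->
  exists d, is_cderive (fun z => F (plus x (scal z h))) z d.
Proof.
intros h0 hz; destruct (dF _ (line_in z h0 hz)) as [l Hl].
exists (l h); now apply is_cderive_line.
Qed.

Let line_zero : plus x (scal (RtoC 0) h) = x.
Proof. etransitivity; [|apply plus_zero_r]; f_equal; exact (scal_zero_l h). Qed.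

Let line_one : plus x (scal (RtoC 1) h) = plus x h.
Proof. f_equal; exact (scal_one h). Qed.

Let norm_zero_h : norm h = 0 -> plus x h = x.
Proof. intros E; apply norm_eq_zero in E; rewrite E; apply plus_zero_r. Qed.

(** On the complex line [z |-> x + z h] this is the one-variable bound at [z = 1] in the disc of
    radius [rho / norm h]. The case [norm h = 0] is separate, as that radius is then meaningless. *)
Lemma holomorphic_lipschitz : norm h <= rho / 2 ->
  Cmod (F (plus x h) - F x) <= 16 * M / rho * norm h.
Proof.
intros hh.
destruct (norm_ge_0 h) as [h0|h0].
- assert (L := bounded_holomorphic_lipschitz (fun z => F (plus x (scal z h))) (rho / norm h) M 0 1).
  cbv beta in L.
  replace (0 + 1)%C with (RtoC 1) in L by ring.
  rewrite line_zero, line_one, Cmod_1 in L.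
  replace (16 * M / rho * norm h) with (16 * M / (rho / norm h) * 1) by (field; lra).
  apply L.
  + now apply Rdiv_lt_0_compat.
  + intros z hz; apply line_holo; [exact h0|]; now replace z with (z - 0)%C by ring.
  + intros z hz; apply FM, line_in; [exact h0|]; now replace z with (z - 0)%C by ring.
  + apply (Rmult_le_reg_r (norm h)); [exact h0|].
    replace (rho / norm h / 2 * norm h) with (rho / 2) by (field; lra); lra.
- rewrite (norm_zero_h (eq_sym h0)), <- h0.
  replace (F x - F x)%C with (RtoC 0) by ring; rewrite Cmod_0; lra.
Qed.

Lemma holomorphic_taylor (l : V -> C) : filterdiff F (locally x) l -> norm h <= rho / 4 ->
  Cmod (F (plus x h) - F x - l h) <= 1024 * M / rho ^ 2 * norm h ^ 2.
Proof.
intros Hl hh.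
destruct (norm_ge_0 h) as [h0|h0].
- assert (T := taylor_le (fun z => F (plus x (scal z h))) (rho / norm h) M).
  assert (T' := T (Rdiv_lt_0_compat _ _ rho0 h0) (fun z => line_holo z h0)
    (fun z hz => FM _ (line_in z h0 hz)) (l h) (RtoC 1)); clear T.
  cbv beta in T'; rewrite line_zero, line_one, Cmod_1, Cmult_1_r in T'.
  replace (1024 * M / rho ^ 2 * norm h ^ 2) with (1024 * M / (rho / norm h) ^ 2 * 1 ^ 2) by (field; lra).
  apply T'.
  + apply is_cderive_line; now rewrite line_zero.
  + apply (Rmult_le_reg_r (norm h)); [exact h0|].
    replace (rho / norm h / 4 * norm h) with (rho / 4) by (field; lra); lra.
- rewrite (norm_zero_h (eq_sym h0)).
  assert (E : h = zero) by now apply norm_eq_zero.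
  replace (l h) with (RtoC 0).
  + replace (F x - F x - 0)%C with (RtoC 0) by ring; rewrite Cmod_0, <- h0; apply Req_le; ring.
  + rewrite E; symmetry; exact (linear_zero l (proj1 Hl)).
Qed.

End Holomorphic.

(* The differentials at [x] converge pointwise: the uniform Taylor bound makes
   [l_n h] close to the difference quotient of [Fn n], which converges. *)
Lemma holomorphic_limit {V : NormedModule C_AbsRing} (Fn : nat -> V -> C) (F : V -> C)
    (x : V) (rho M : R) :
  0 < rho ->
  (forall n (y : V), norm (minus y x) < rho -> ex_filterdiff (Fn n) (locally y)) ->
  (forall n (y : V), norm (minus y x) < rho -> Cmod (Fn n y) <= M) ->
  (forall y : V, norm (minus y x) < rho ->
     filterlim (fun n => Fn n y) eventually (locally (F y))) ->
  ex_filterdiff F (locally x).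
Proof.
intros rho0 dF FM lim.
assert (hx : norm (minus x x) < rho) by (rewrite norm_minus_self; exact rho0).
destruct (choice _ (fun n => dF n x hx)) as [ln Hln].
assert (M0 : 0 <= M) by (eapply Rle_trans; [apply Cmod_ge_0|exact (FM O x hx)]).
set (K := 1024 * M / rho ^ 2).
assert (K0 : 0 <= K) by (apply Rdiv_le_0_compat; [lra|apply pow_lt, rho0]).
assert (T : forall n h, norm h <= rho / 4 ->
  Cmod (Fn n (plus x h) - Fn n x - ln n h) <= K * norm h ^ 2).
{ intros n h hh; apply (holomorphic_taylor V (Fn n) x h rho M rho0 (dF n) (FM n)); auto. }
assert (near : forall h, norm h <= rho / 4 -> norm (minus (plus x h) x) < rho).
{ intros h hh; rewrite minus_plus_l; lra. }
assert (exl : forall h, exists l : C, filterlim (fun n => ln n h) eventually (locally l)).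
{ intros h; apply (CompleteNormedModule_sequentially_complete C_CompleteNormedModule); intros eps he.
  assert (h0 := norm_ge_0 h).
  (* Scaling by [t] brings [h] into the range of the Taylor bound [T] and makes each Taylor
     remainder at most [t * eps / 4]. Two such remainders and four limit errors below [t * eps / 8]
     sum to less than [t * eps]. *)
  set (t := Rmin (rho / 4 / (norm h + 1)) (eps / 4 / (K * norm h ^ 2 + 1))).
  assert (q0 : 0 <= K * norm h ^ 2) by (apply Rmult_le_pos; [exact K0|apply pow2_ge_0]).
  assert (t0 : 0 < t) by (apply Rmin_glb_lt; apply Rdiv_lt_0_compat; lra).
  assert (t1 : t * norm h <= rho / 4).
  { apply Rle_trans with (t * (norm h + 1)); [nra|].
    apply Rle_div_r; [lra|apply Rmin_l]. }
  assert (t2 : t * (K * norm h ^ 2) <= eps / 4).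
  { apply Rle_trans with (t * (K * norm h ^ 2 + 1)); [nra|].
    apply Rle_div_r; [lra|apply Rmin_r]. }
  set (th := scal (RtoC t) h).
  assert (Nth : norm th <= t * norm h).
  { eapply Rle_trans; [apply norm_scal_le|]; rewrite Cmod_R, Rabs_right; lra. }
  assert (Nth' : norm th <= rho / 4) by lra.
  assert (e1 : 0 < t * eps / 8) by nra.
  destruct (proj1 (filterlim_eventually_norm _ _) (lim _ (near th Nth')) _ e1) as [N1 HN1].
  destruct (proj1 (filterlim_eventually_norm _ _) (lim _ hx) _ e1) as [N2 HN2].
  exists (max N1 N2); intros n m hn hm.
  change (Cmod (ln n h - ln m h) < eps).
  assert (A1 := HN1 n ltac:(lia)); assert (A2 := HN1 m ltac:(lia)).
  assert (A3 := HN2 n ltac:(lia)); assert (A4 := HN2 m ltac:(lia)).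
  assert (B1 := T n th Nth'); assert (B2 := T m th Nth').
  unfold th in B1 at 2; unfold th in B2 at 2.
  rewrite (linear_scal _ (proj1 (Hln n))) in B1; rewrite (linear_scal _ (proj1 (Hln m))) in B2.
  change (scal (RtoC t) (ln n h)) with (t * ln n h)%C in B1.
  change (scal (RtoC t) (ln m h)) with (t * ln m h)%C in B2.
  change (Cmod (Fn n (plus x th) - F (plus x th)) < t * eps / 8) in A1.
  change (Cmod (Fn m (plus x th) - F (plus x th)) < t * eps / 8) in A2.
  change (Cmod (Fn n x - F x) < t * eps / 8) in A3.
  change (Cmod (Fn m x - F x) < t * eps / 8) in A4.
  set (a := Fn n (plus x th)) in *; set (a' := Fn m (plus x th)) in *; set (b := Fn n x) in *.
  set (b' := Fn m x) in *; set (c := F (plus x th)) in *; set (c' := F x) in *.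
  assert (Q : K * norm th ^ 2 <= t * (eps / 4)).
  { apply Rle_trans with (t * (t * (K * norm h ^ 2))).
    - replace (t * (t * (K * norm h ^ 2))) with (K * (t * norm h) ^ 2) by ring.
      apply Rmult_le_compat_l; [exact K0|].
      apply pow_incr; split; [apply norm_ge_0|exact Nth].
    - apply Rmult_le_compat_l; lra. }
  apply (Rmult_lt_reg_l t); [exact t0|].
  replace (t * Cmod (ln n h - ln m h)) with (Cmod (t * (ln n h - ln m h)))
    by (rewrite Cmod_mult, Cmod_R, Rabs_right; lra).
  replace (t * (ln n h - ln m h))%C with
    (- (a - b - t * ln n h) + ((a' - b' - t * ln m h) + ((a - c) + (- (a' - c) + (- (b - c') + (b' - c'))))))%C
    by ring.
  eapply Rle_lt_trans; [apply Cmod_triangle|].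
  eapply Rle_lt_trans; [apply Rplus_le_compat_l; eapply Rle_trans; [apply Cmod_triangle|];
    apply Rplus_le_compat_l; eapply Rle_trans; [apply Cmod_triangle|];
    apply Rplus_le_compat_l; eapply Rle_trans; [apply Cmod_triangle|];
    apply Rplus_le_compat_l; apply Cmod_triangle|].
  rewrite ?Cmod_opp; lra. }
destruct (choice _ exl) as [l Hl]; clear exl.
assert (TF : forall h, norm h <= rho / 4 -> Cmod (F (plus x h) - F x - l h) <= K * norm h ^ 2).
{ intros h hh.
  apply (filterlim_norm_le (V := C_NormedModule) (fun n => Fn n (plus x h) - Fn n x - ln n h)%C).
  - apply (filterlim_seq_minus (V := C_NormedModule)); [|apply Hl].
    apply (filterlim_seq_minus (V := C_NormedModule)); apply lim; [apply near, hh|exact hx].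
  - intros n; apply T, hh. }
assert (uniq : forall (u : nat -> C) a b, filterlim u eventually (locally a) ->
  filterlim u eventually (locally b) -> a = b).
{ intros u a b; exact (filterlim_locally_unique (V := C_NormedModule) u a b). }
assert (lscal : forall (k : C) h, l (scal k h) = (k * l h)%C).
{ intros k h; apply (uniq (fun n => ln n (scal k h))); [apply Hl|].
  apply (filterlim_ext (fun n => k * ln n h)%C).
  - intros n; symmetry; exact (linear_scal _ (proj1 (Hln n)) k h).
  - exact (filterlim_seq_scal (V := C_NormedModule) k _ _ (Hl h)). }
assert (FM' : forall y, norm (minus y x) < rho -> Cmod (F y) <= M).
{ intros y hy; apply (filterlim_norm_le (V := C_NormedModule) (fun n => Fn n y)); [now apply lim|].
  intros n; now apply FM. }
assert (lin : is_linear l).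
{ split.
  - intros h k; apply (uniq (fun n => ln n (plus h k))); [apply Hl|].
    apply (filterlim_ext (fun n => ln n h + ln n k)%C).
    + intros n; symmetry; exact (linear_plus _ (proj1 (Hln n)) h k).
    + exact (filterlim_seq_plus (V := C_NormedModule) _ _ _ _ (Hl h) (Hl k)).
  - exact lscal.
  (* Continuity of the limit [l]: after rescaling [h] to norm at most [rho / 4], the estimate [TF]
     and the bound [M] on [F] give [t * Cmod (l h) <= B]. The 1 added to [B] makes the operator
     bound positive. *)
  - set (B := 2 * M + K * (rho / 4) ^ 2).
    assert (B0 : 0 <= B).
    { unfold B; assert (0 <= K * (rho / 4) ^ 2) by (apply Rmult_le_pos; [exact K0|apply pow2_ge_0]); lra. }
    exists ((B + 1) * (4 / rho)); split.
    + apply Rmult_lt_0_compat; [lra|apply Rdiv_lt_0_compat; lra].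
    + intros h; change (Cmod (l h) <= (B + 1) * (4 / rho) * norm h).
      destruct (norm_ge_0 h) as [h0|h0].
      * set (t := rho / 4 / norm h).
        assert (t0 : 0 < t) by (apply Rdiv_lt_0_compat; lra).
        assert (Nt : norm (scal (RtoC t) h) <= rho / 4).
        { eapply Rle_trans; [apply norm_scal_le|]; rewrite Cmod_R, Rabs_right by lra.
          apply Req_le; unfold t; field; lra. }
        assert (A := TF _ Nt); assert (A1 := FM' _ (near _ Nt)); assert (A2 := FM' _ hx).
        rewrite lscal in A.
        assert (Q : K * norm (scal (RtoC t) h) ^ 2 <= K * (rho / 4) ^ 2).
        { apply Rmult_le_compat_l; [exact K0|]; apply pow_incr; split; [apply norm_ge_0|exact Nt]. }
        set (a := F (plus x (scal (RtoC t) h))) in *.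
        assert (U : t * Cmod (l h) <= B).
        { replace (t * Cmod (l h)) with (Cmod (t * l h)) by (rewrite Cmod_mult, Cmod_R, Rabs_right; lra).
          replace (t * l h)%C with (- (a - F x - t * l h) + (a + - F x))%C by ring.
          eapply Rle_trans; [apply Cmod_triangle|].
          assert (Z := Cmod_triangle a (- F x)); rewrite Cmod_opp in *; unfold B; lra. }
        apply (Rmult_le_reg_l t); [exact t0|].
        replace (t * ((B + 1) * (4 / rho) * norm h)) with (B + 1) by (unfold t; field; lra); lra.
      * assert (E : h = scal (RtoC 0) h).
        { transitivity (@zero V); [now apply norm_eq_zero|symmetry; exact (scal_zero_l h)]. }
        rewrite E, lscal, Cmult_0_l, Cmod_0, <- E, <- h0; lra. }
exists l; apply eps_filterdiff; [exact lin|]; intros eps.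
assert (d0 : 0 < Rmin (rho / 4) (eps / (K + 1))).
{ apply Rmin_glb_lt; [lra|apply Rdiv_lt_0_compat; [apply cond_pos|lra]]. }
exists (mkposreal _ d0); simpl; intros y hy.
assert (h1 := Rlt_le_trans _ _ _ hy (Rmin_l _ _)); assert (h2 := Rlt_le_trans _ _ _ hy (Rmin_r _ _)).
assert (A := TF (minus y x) ltac:(lra)).
rewrite plus_minus_r in A.
eapply Rle_trans; [exact A|].
assert (n0 := norm_ge_0 (minus y x)).
apply Rlt_div_r in h2; [|lra].
replace (K * norm (minus y x) ^ 2) with (norm (minus y x) * K * norm (minus y x)) by ring.
apply Rmult_le_compat_r; [exact n0|nra].
Qed.

(** * The coefficient functionals of a Schauder basis *)

Lemma dist_sym {K : AbsRing} {V : NormedModule K} (x y : V) : norm (minus x y) = norm (minus y x).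
Proof.
transitivity (norm (opp (minus y x))); [|apply norm_opp].
f_equal; symmetry; exact (opp_minus y x).
Qed.

Lemma dist_triangle {K : AbsRing} {V : NormedModule K} (y x z : V) :
  norm (minus x z) <= norm (minus x y) + norm (minus y z).
Proof.
eapply Rle_trans; [|apply norm_triangle].
apply Req_le; f_equal; exact (minus_trans y x z).
Qed.

Lemma norm_minus_le {K : AbsRing} {V : NormedModule K} (x y : V) :
  norm (minus x y) <= norm x + norm y.
Proof.
eapply Rle_trans; [apply norm_triangle|]; apply Req_le; f_equal; apply norm_opp.
Qed.

Lemma minus_minus_minus {G : AbelianGroup} (p q a b : G) :
  minus (minus p q) (minus a b) = minus (minus p a) (minus q b).
Proof.
assert (inter : forall w x y z : G, plus (plus w x) (plus y z) = plus (plus w y) (plus x z)).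
{ intros w x y z.
  rewrite <- (plus_assoc w x), <- (plus_assoc w y); f_equal.
  rewrite (plus_assoc x y), (plus_assoc y x); f_equal; apply plus_comm. }
transitivity (plus (plus p (opp q)) (plus (opp a) (opp (opp b)))).
- exact (f_equal (plus (minus p q)) (opp_plus a (opp b))).
- etransitivity; [apply inter|].
  exact (f_equal (plus (minus p a)) (eq_sym (opp_plus q (opp b)))).
Qed.

Lemma minus_minus_self {G : AbelianGroup} (x a : G) : minus x (minus x a) = a.
Proof.
transitivity (minus (minus x zero) (minus x a)).
- f_equal; symmetry; exact (minus_zero_r x).
- etransitivity; [apply minus_minus_minus|].
  rewrite minus_eq_zero.
  etransitivity; [exact (f_equal (minus zero) (plus_zero_l (opp a)))|].
  etransitivity; [exact (plus_zero_l (opp (opp a)))|apply opp_opp].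
Qed.

Lemma norm_scal_C {V : NormedModule C_AbsRing} (k : C) (x : V) :
  norm (scal k x) = Cmod k * norm x.
Proof.
apply Rle_antisym; [apply norm_scal_le|].
destruct (Ceq_dec k 0) as [->|hk].
- rewrite Cmod_0, Rmult_0_l; apply norm_ge_0.
- assert (k0 : 0 < Cmod k) by now apply Cmod_gt_0.
  apply (Rmult_le_reg_l (/ Cmod k)); [now apply Rinv_0_lt_compat|].
  rewrite <- Rmult_assoc, Rinv_l, Rmult_1_l by lra.
  rewrite <- (Cmod_inv k hk).
  eapply Rle_trans; [|apply norm_scal_le].
  apply Req_le; f_equal; symmetry.
  transitivity (scal (mult (/ k)%C k) x); [apply scal_assoc|].
  replace (mult (/ k)%C k) with (@one C_Ring); [exact (scal_one x)|].
  symmetry; exact (Cinv_l k hk).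
Qed.

(** * Baire category in sequential form *)

Lemma geometric_limit {V : NormedModule C_AbsRing}
  (complete : sequentially_complete V)
  (u : nat -> V) (r : nat -> R) :
  (forall n, 0 < r n) -> (forall n, r (S n) <= r n / 2) ->
  (forall n, norm (minus (u (S n)) (u n)) <= r n / 2) ->
  exists x, forall n, norm (minus x (u n)) <= r n.
Proof.
intros r0 rS Hu.
(* The subtracted [r (k + n)] closes the induction: one more step moves by at most [r (k + n) / 2],
   and the radius drops by at least that much. *)
assert (tail : forall n k, norm (minus (u (k + n)%nat) (u n)) <= r n - r (k + n)%nat).
{ intros n k; induction k as [|k IH]; simpl.
  - rewrite norm_minus_self; lra.
  - eapply Rle_trans; [apply (dist_triangle (u (k + n)%nat))|].
    specialize (Hu (k + n)%nat); specialize (rS (k + n)%nat); lra. }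
assert (tail' : forall n m, (n <= m)%nat -> norm (minus (u m) (u n)) <= r n).
{ intros n m hm; replace m with ((m - n) + n)%nat by lia.
  specialize (tail n (m - n)%nat); specialize (r0 ((m - n) + n)%nat); lra. }
assert (rpow : forall n, r n <= r O * (/ 2) ^ n).
{ intros n; induction n as [|n IH]; simpl; [lra|].
  specialize (rS n); lra. }
destruct (complete u) as [x Hx].
- intros eps he.
  destruct (pow_lt_1_zero (/ 2) ltac:(rewrite Rabs_right; lra) (eps / 2 / r O)) as [N HN].
  { apply Rdiv_lt_0_compat; [lra|apply r0]. }
  exists N; intros n m hn hm.
  specialize (HN N (Nat.le_refl _)).
  rewrite Rabs_right in HN by (apply Rle_ge, pow_le; lra).
  apply Rlt_div_r in HN; [|apply r0].
  specialize (rpow N).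
  eapply Rle_lt_trans; [apply (dist_triangle (u N))|].
  rewrite (dist_sym (u N)).
  assert (A := tail' N n hn); assert (B := tail' N m hm); lra.
- exists x; intros n; apply Rnot_lt_le; intros bad.
  destruct (proj1 (filterlim_eventually_norm u x) Hx (norm (minus x (u n)) - r n)) as [N HN]; [lra|].
  specialize (HN (max N n) (Nat.le_max_l _ _)).
  assert (T := tail' n (max N n) (Nat.le_max_r _ _)).
  assert (D := dist_triangle (u (max N n)) x (u n)).
  rewrite (dist_sym x (u (max N n))) in D; lra.
Qed.

(** If no [A m] were dense in any ball, shrinking balls whose step [m] moves away from [A m] would
    converge to a point lying in no [A m]. The conclusion speaks of density because the sets are not
    assumed closed. *)
Lemma baire_cover {V : NormedModule C_AbsRing}
  (complete : sequentially_complete V)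
  (A : nat -> V -> Prop) :
  (forall x, exists m, A m x) ->
  exists m (x0 : V) eps, 0 < eps /\ forall y : V, norm (minus y x0) < eps ->
    forall delta, 0 < delta -> exists a : V, A m a /\ norm (minus y a) < delta.
Proof.
intros cover; apply NNPP; intros N.
assert (step : forall m x0 eps, 0 < eps -> exists y delta, norm (minus y x0) < eps /\ 0 < delta /\
  forall a, A m a -> delta <= norm (minus y a)).
{ intros m x0 eps he; apply NNPP; intros N1; apply N.
  exists m, x0, eps; split; [exact he|]; intros y hy delta hd.
  apply NNPP; intros N2; apply N1; exists y, delta; repeat split; try assumption.
  intros a ha; apply Rnot_lt_le; intros h; apply N2; now exists a. }
(* A state is a centre and a radius. The limit lies within the new radius of the new centre, while
   points of [A m] stay at twice that radius; this excludes the limit from [A m]. *)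
destruct (dependent_choice (fun _ (z : V * R) => 0 < snd z)
  (fun m z z' => norm (minus (fst z') (fst z)) <= snd z / 2 /\ snd z' <= snd z / 2 /\
     forall a, A m a -> 2 * snd z' <= norm (minus (fst z') a))) with (a0 := (@zero V, 1))
  as (s & _ & Hs).
- intros m [x eps]; simpl; intros he.
  destruct (step m x (eps / 2)) as (y & delta & h1 & h2 & h3); [lra|].
  exists (y, Rmin (eps / 2) (delta / 2)); simpl; repeat split.
  + apply Rmin_glb_lt; lra.
  + lra.
  + apply Rmin_l.
  + intros a ha; specialize (h3 a ha); generalize (Rmin_r (eps / 2) (delta / 2)); lra.
- simpl; lra.
- destruct (geometric_limit complete (fun n => fst (s n)) (fun n => snd (s n))) as [x Hx];
    try (intros n; apply Hs).
  destruct (cover x) as [m Hm].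
  destruct (Hs m) as (_ & _ & _ & H); specialize (H x Hm).
  specialize (Hx (S m)); rewrite dist_sym in Hx.
  destruct (Hs (S m)) as [h _]; lra.
Qed.

Section Coefficients.

Variables (X : NormedModule C_AbsRing) (e : nat -> X).
Hypothesis he : schauder_basis e.

Lemma coef_unique (c : nat -> C) (x : X) (j : nat) :
  is_series (fun i => scal (c i) (e i)) x -> coef e j x = c j.
Proof.
intros H; destruct (he x) as [c' [_ U]].
rewrite <- (U c H).
now rewrite (U (fun j => coef e j x) (coef_series e x he)).
Qed.

Lemma coef_plus (x y : X) j : coef e j (plus x y) = (coef e j x + coef e j y)%C.
Proof.
apply (coef_unique (fun j => coef e j x + coef e j y)%C).
apply (is_series_ext (fun i => plus (scal (coef e i x) (e i)) (scal (coef e i y) (e i)))).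
- intros i; symmetry; exact (scal_distr_r (coef e i x : C_Ring) (coef e i y) (e i)).
- apply (is_series_plus (V := X)); now apply coef_series.
Qed.

Lemma coef_scal (k : C) (x : X) j : coef e j (scal k x) = (k * coef e j x)%C.
Proof.
apply (coef_unique (fun j => k * coef e j x)%C).
apply (is_series_ext (fun i => scal k (scal (coef e i x) (e i)))).
- intros i; exact (scal_assoc (k : C_Ring) (coef e i x) (e i)).
- apply (is_series_scal_l (V := X) k); now apply coef_series.
Qed.

Definition basis_sum (x : X) (n : nat) : X := sum_n (fun j => scal (coef e j x) (e j)) n.

Lemma basis_sum_lim (x : X) : filterlim (basis_sum x) eventually (locally x).
Proof. exact (coef_series e x he). Qed.

Lemma basis_sum_plus (x y : X) n : basis_sum (plus x y) n = plus (basis_sum x n) (basis_sum y n).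
Proof.
unfold basis_sum; etransitivity; [|apply sum_n_plus].
apply sum_n_ext; intros j; rewrite coef_plus.
exact (scal_distr_r (coef e j x : C_Ring) (coef e j y) (e j)).
Qed.

Lemma basis_sum_scal (k : C) (x : X) n : basis_sum (scal k x) n = scal k (basis_sum x n).
Proof.
unfold basis_sum; etransitivity; [|exact (sum_n_scal_l (K := C_Ring) (V := X) k (fun j => scal (coef e j x) (e j)) n)].
apply sum_n_ext; intros j; rewrite coef_scal.
symmetry; exact (scal_assoc (k : C_Ring) (coef e j x) (e j)).
Qed.

Lemma minus_as_scal (x y : X) : minus x y = plus x (scal (- (1))%C y).
Proof. unfold minus; f_equal; symmetry; exact (scal_opp_one y). Qed.

Lemma basis_sum_minus (x y : X) n : basis_sum (minus x y) n = minus (basis_sum x n) (basis_sum y n).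
Proof. now rewrite !minus_as_scal, basis_sum_plus, basis_sum_scal. Qed.

Lemma coef_minus (x y : X) j : coef e j (minus x y) = (coef e j x - coef e j y)%C.
Proof. rewrite minus_as_scal, coef_plus, coef_scal; ring. Qed.

Hypothesis he1 : normalized e.

(** Each term of the expansion is a partial sum or a difference of two consecutive ones, and its
    norm is the modulus of the coefficient because the basis is normalized. *)
Lemma coef_le (x : X) (B : R) j :
  (forall n, norm (basis_sum x n) <= B) -> Cmod (coef e j x) <= 2 * B.
Proof.
intros HB.
replace (Cmod (coef e j x)) with (norm (scal (coef e j x) (e j)))
  by (rewrite norm_scal_C, he1; ring).
assert (B0 : 0 <= B) by (exact (Rle_trans _ _ _ (norm_ge_0 _) (HB O))).
destruct j as [|j].
- replace (scal (coef e 0 x) (e 0%nat)) with (basis_sum x 0).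
  + specialize (HB O); lra.
  + unfold basis_sum; apply sum_O.
- replace (scal (coef e (S j) x) (e (S j))) with (minus (basis_sum x (S j)) (basis_sum x j)).
  + eapply Rle_trans; [apply norm_minus_le|]; assert (A1 := HB j); assert (A2 := HB (S j)); lra.
  + unfold basis_sum; rewrite sum_Sn; apply (minus_plus_l (V := X)).
Qed.

Hypothesis complete : sequentially_complete X.

(** Baire's theorem, applied to the sets where all partial sums are bounded by [m]. These sets are
    not known to be closed, so only an approximation [a] of [x] results, as in the first half of the
    open mapping theorem. *)
Lemma approx_bounded_sums : exists K, 0 <= K /\ forall (x : X) delta, 0 < delta ->
  exists a : X, norm (minus x a) < delta /\ forall n, norm (basis_sum a n) <= K * norm x.
Proof.
destruct (baire_cover complete (fun m x => forall n, norm (basis_sum x n) <= INR m))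
  as (m & x0 & eps & he0 & dense).
{ intros x; destruct (filterlim_bounded (basis_sum x) (ex_intro _ x (basis_sum_lim x))) as [M HM].
  destruct (nfloor_ex (Rmax M 0)) as [k [_ hk]]; [apply Rmax_r|].
  exists (S k); intros n; rewrite S_INR; specialize (HM n); generalize (Rmax_l M 0); lra. }
assert (m0 := pos_INR m).
exists (4 * INR m / eps); split; [apply Rdiv_le_0_compat; lra|].
intros x delta hd.
destruct (norm_ge_0 x) as [hx|hx].
(* [t] scales [x] to norm [eps / 2], inside the ball around [x0]. The approximants [a] of [x0 + t x]
   and [b] of [x0] have partial sums at most [m], so those of [(a - b) / t] are at most [2 m / t],
   that is [4 m / eps * norm x]. *)
- set (t := eps / (2 * norm x)).
  assert (t0 : 0 < t) by (apply Rdiv_lt_0_compat; lra).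
  assert (exists sx : X, sx = scal (RtoC t) x) as [sx Esx] by now eexists.
  destruct (dense (plus x0 sx)) with (delta := t * delta / 2) as (a & ha & ha').
  { replace (minus (plus x0 sx) x0) with sx by (symmetry; exact (minus_plus_l x0 sx)).
    rewrite Esx, norm_scal_C, Cmod_R, Rabs_right by lra.
    replace (t * norm x) with (eps / 2) by (unfold t; field; lra); lra. }
  { nra. }
  destruct (dense x0) with (delta := t * delta / 2) as (b & hb & hb').
  { rewrite norm_minus_self; lra. }
  { nra. }
  exists (scal (RtoC (/ t)) (minus a b)); split.
  + assert (Ex : x = scal (RtoC (/ t)) sx).
    { rewrite Esx; transitivity (scal (mult (RtoC (/ t)) (RtoC t)) x); [|symmetry; apply scal_assoc].
      replace (mult (RtoC (/ t)) (RtoC t)) with (@one C_Ring); [symmetry; exact (scal_one x)|].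
      change (RtoC 1 = (RtoC (/ t) * RtoC t)%C); rewrite <- RtoC_mult; f_equal; field; lra. }
    rewrite Ex.
    replace (minus _ _) with (scal (RtoC (/ t)) (minus sx (minus a b)))
      by (exact (scal_minus_distr_l (RtoC (/ t) : C_Ring) _ _)).
    rewrite norm_scal_C, Cmod_R, Rabs_right by (apply Rle_ge; left; now apply Rinv_0_lt_compat).
    apply (Rmult_lt_reg_l t); [exact t0|].
    rewrite <- Rmult_assoc, Rinv_r, Rmult_1_l by lra.
    rewrite <- (minus_plus_l x0 sx).
    replace (minus (minus _ _) _) with (minus (minus (plus x0 sx) a) (minus x0 b))
      by (symmetry; exact (minus_minus_minus _ _ _ _)).
    eapply Rle_lt_trans; [apply norm_minus_le|]; lra.
  + intros n; rewrite basis_sum_scal, basis_sum_minus, norm_scal_C, Cmod_R, Rabs_right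
      by (apply Rle_ge; left; now apply Rinv_0_lt_compat).
    apply (Rmult_le_reg_l t); [exact t0|].
    rewrite <- Rmult_assoc, Rinv_r, Rmult_1_l by lra.
    eapply Rle_trans; [apply norm_minus_le|].
    replace (t * (4 * INR m / eps * norm x)) with (2 * INR m) by (unfold t; field; lra).
    specialize (ha n); specialize (hb n); lra.
- exists x; split; [rewrite norm_minus_self; exact hd|]; intros n.
  assert (E : x = scal (RtoC 0) x).
  { transitivity (@zero X); [now apply norm_eq_zero|symmetry; exact (scal_zero_l x)]. }
  rewrite E at 1; rewrite basis_sum_scal, norm_scal_C, Cmod_0, <- hx; lra.
Qed.

(* Successive approximation: the coefficients of the remainders [y k] converge, and their
   limits are the coefficients of [0]. *)
Lemma basis_sum_bounded : exists K, 0 <= K /\ forall (x : X) n, norm (basis_sum x n) <= K * norm x.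
Proof.
destruct approx_bounded_sums as (K & K0 & approx).
exists (2 * K); split; [lra|]; intros x n.
destruct (norm_ge_0 x) as [hx|hx].
2:{ assert (E : x = scal (RtoC 0) x).
    { transitivity (@zero X); [now apply norm_eq_zero|symmetry; exact (scal_zero_l x)]. }
    rewrite E at 1; rewrite basis_sum_scal, norm_scal_C, Cmod_0, <- hx; lra. }
set (T := norm x) in *.
assert (p2 : forall k, 0 < (/ 2) ^ k) by (intros k; apply pow_lt; lra).
(* [y k] is what is left of [x] after [k] approximations. The partial sums of the pieces removed are
   bounded by a geometric sequence of total [2 * K * T]. *)
destruct (dependent_choice (fun k y => norm y <= T * (/ 2) ^ k)
  (fun k y y' => forall n, norm (basis_sum (minus y y') n) <= K * T * (/ 2) ^ k)) with (a0 := x)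
  as (y & y0 & Hy).
{ intros k v hv.
  destruct (approx v (T * (/ 2) ^ S k)) as (a & ha & ha').
  { apply Rmult_lt_0_compat; [exact hx|apply p2]. }
  exists (minus v a); split; [now left|]; intros i.
  replace (minus v (minus v a)) with a by (symmetry; exact (minus_minus_self v a)).
  eapply Rle_trans; [apply ha'|]; rewrite Rmult_assoc; now apply Rmult_le_compat_l. }
{ simpl; unfold T; lra. }
assert (tel : forall k j i, norm (basis_sum (minus (y k) (y (j + k)%nat)) i)
  <= 2 * K * T * (/ 2) ^ k - 2 * K * T * (/ 2) ^ (j + k)).
{ intros k j i; induction j as [|j IH]; simpl.
  - rewrite basis_sum_minus, norm_minus_self; lra.
  - rewrite basis_sum_minus in IH |- *.
    eapply Rle_trans; [apply (dist_triangle (basis_sum (y (j + k)%nat) i))|].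
    destruct (Hy (j + k)%nat) as [_ H]; specialize (H i); rewrite basis_sum_minus in H; lra. }
assert (tail : forall k l i, (k <= l)%nat ->
  norm (basis_sum (minus (y k) (y l)) i) <= 2 * K * T * (/ 2) ^ k).
{ intros k l i hl; replace l with ((l - k) + k)%nat by lia.
  eapply Rle_trans; [apply tel|].
  assert (0 <= 2 * K * T * (/ 2) ^ ((l - k) + k)); [|lra].
  apply Rmult_le_pos; [nra|left; apply p2]. }
assert (small : forall eps, 0 < eps -> forall B, 0 <= B -> exists k, B * (/ 2) ^ k < eps).
{ intros eps heps B hB.
  destruct (pow_lt_1_zero (/ 2) ltac:(rewrite Rabs_right; lra) (eps / (B + 1))) as [N HN].
  { apply Rdiv_lt_0_compat; lra. }
  exists N; specialize (HN N (Nat.le_refl _)).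
  rewrite Rabs_right in HN by (apply Rle_ge; left; apply p2).
  apply Rlt_div_r in HN; [|lra]; specialize (p2 N); lra. }
(* The coefficients are not yet known to be continuous, so the convergence of [y k] to 0 does not by
   itself control them. The bounds on the partial sums of differences make them Cauchy. *)
assert (exd : forall j, exists d : C, filterlim (fun k => coef e j (y k)) eventually (locally d)).
{ intros j; apply (CompleteNormedModule_sequentially_complete C_CompleteNormedModule); intros eps heps.
  destruct (small (eps / 2) ltac:(lra) (2 * (2 * K * T)) ltac:(nra)) as [N HN].
  exists N.
  assert (C1 : forall l, (N <= l)%nat -> Cmod (coef e j (y N) - coef e j (y l)) < eps / 2).
  { intros l hl; rewrite <- coef_minus.
    eapply Rle_lt_trans; [apply coef_le; intros i; apply (tail N l i hl)|]; lra. }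
  intros a b ha hb.
  eapply Rle_lt_trans; [apply (dist_triangle (V := C_NormedModule) (coef e j (y N) : C))|].
  rewrite (dist_sym (V := C_NormedModule)).
  assert (A1 := C1 a ha); assert (A2 := C1 b hb).
  change (Cmod (coef e j (y N) - coef e j (y a)) + Cmod (coef e j (y N) - coef e j (y b)) < eps); lra. }
destruct (choice _ exd) as [d Hd].
set (D := sum_n (fun j => scal (d j) (e j))).
assert (limP : forall i, filterlim (fun k => basis_sum (y k) i) eventually (locally (D i))).
{ intros i; unfold D, basis_sum.
  assert (term : forall j, filterlim (fun k => scal (coef e j (y k)) (e j)) eventually (locally (scal (d j) (e j)))).
  { intros j; apply filterlim_eventually_norm; intros eps heps.
    destruct (proj1 (filterlim_eventually_norm (V := C_NormedModule) _ _) (Hd j) eps heps) as [N HN].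
    exists N; intros k hk.
    replace (minus _ _) with (scal (coef e j (y k) - d j)%C (e j))
      by (exact (scal_minus_distr_r (coef e j (y k) : C_Ring) (d j) (e j))).
    rewrite norm_scal_C, he1, Rmult_1_r; exact (HN k hk). }
  induction i as [|i IH].
  - rewrite sum_O; apply (filterlim_ext (fun k => scal (coef e 0 (y k)) (e 0%nat))); [|apply term].
    intros k; now rewrite sum_O.
  - rewrite sum_Sn.
    apply (filterlim_ext (fun k => plus (sum_n (fun j => scal (coef e j (y k)) (e j)) i)
      (scal (coef e (S i) (y k)) (e (S i))))); [intros k; now rewrite sum_Sn|].
    exact (filterlim_seq_plus (V := X) _ _ _ _ IH (term (S i))). }
assert (Dle : forall k i, norm (minus (basis_sum (y k) i) (D i)) <= 2 * K * T * (/ 2) ^ k).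
{ intros k i; apply (filterlim_norm_le (fun l => minus (basis_sum (y k) i) (basis_sum (y (l + k)%nat) i))).
  - apply (filterlim_seq_minus (fun _ => basis_sum (y k) i)); [apply filterlim_const|].
    apply (filterlim_comp _ _ _ (fun l => (l + k)%nat) (fun l => basis_sum (y l) i) _ eventually);
      [|apply limP].
    intros P [N HN]; exists N; intros l hl; apply HN; lia.
  - intros l; rewrite <- basis_sum_minus; apply tail; lia. }
(* [Dle] is uniform in [i]: for one large [k], [D i] is close to [basis_sum (y k) i], which for
   large [i] is close to the small vector [y k]. So the [d j] expand 0, and uniqueness makes them
   vanish. *)
assert (D0 : filterlim D eventually (locally (@zero X))).
{ apply filterlim_eventually_norm; intros eps heps.
  destruct (small (eps / 2) ltac:(lra) (2 * K * T + T) ltac:(nra)) as [k Hk].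
  destruct (proj1 (filterlim_eventually_norm _ _) (basis_sum_lim (y k)) (eps / 2)) as [N HN]; [lra|].
  exists N; intros i hi; specialize (HN i hi).
  eapply Rle_lt_trans; [apply (dist_triangle (basis_sum (y k) i))|].
  rewrite dist_sym.
  assert (A1 := Dle k i).
  assert (A2 : norm (minus (basis_sum (y k) i) zero) <= norm (minus (basis_sum (y k) i) (y k)) + norm (y k)).
  { eapply Rle_trans; [apply (dist_triangle (y k))|].
    apply Req_le, f_equal, f_equal; exact (minus_zero_r (y k)). }
  destruct (Hy k) as [A3 _].
  eapply Rle_lt_trans; [apply Rplus_le_compat; [exact A1|exact A2]|]; lra. }
assert (d0 : forall j, d j = RtoC 0).
{ intros j; rewrite <- (coef_unique d zero j D0).
  apply (coef_unique (fun _ => RtoC 0)).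
  apply (filterlim_ext (fun _ : nat => @zero X)); [|apply filterlim_const].
  intros i; induction i as [|i IH].
  - rewrite sum_O; symmetry; exact (scal_zero_l (e 0%nat)).
  - rewrite sum_Sn, <- IH; symmetry; etransitivity; [apply plus_zero_l|exact (scal_zero_l (e (S i)))]. }
assert (Dn : D n = zero).
{ unfold D; clear - d0; induction n as [|n IH].
  - rewrite sum_O, d0; exact (scal_zero_l (e 0%nat)).
  - rewrite sum_Sn, IH, d0; etransitivity; [apply plus_zero_l|exact (scal_zero_l (e (S n)))]. }
specialize (Dle O n); rewrite y0, Dn in Dle; simpl in Dle.
replace (2 * K * T) with (2 * K * T * 1) by ring.
eapply Rle_trans; [|exact Dle].
apply Req_le, f_equal; symmetry; exact (minus_zero_r (basis_sum x n)).
Qed.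

Lemma coef_bounded : exists K, 0 < K /\ forall (x : X) j, Cmod (coef e j x) <= K * norm x.
Proof.
destruct basis_sum_bounded as (K & K0 & HK).
exists (2 * K + 1); split; [lra|]; intros x j.
eapply Rle_trans; [apply coef_le; intros n; apply HK|].
assert (h := norm_ge_0 x); lra.
Qed.

End Coefficients.

(** * The isomorphism *)

(** The entries are eventually below [1 / 2], and the finitely many others have a maximum below 1.
    For bounded sequences not tending to 0 the supremum could be 1. *)
Lemma c0_norm_lt_1 (y : c0) : (forall n, Cmod (y n) < 1) -> c0_norm y < 1.
Proof.
intros H.
destruct (proj1 (filterlim_eventually_norm (V := C_NormedModule) _ _) (c0_lim y) (1 / 2)) as [N HN]; [lra|].
assert (fin : forall N : nat, exists B, B < 1 /\ forall n, (n < N)%nat -> Cmod (y n) <= B).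
{ induction N0 as [|k [B [B1 HB]]]; [exists 0; split; [lra|lia]|].
  exists (Rmax B (Cmod (y k))); split; [now apply Rmax_lub_lt|].
  intros n hn; destruct (Nat.eq_dec n k) as [->|d]; [apply Rmax_r|].
  eapply Rle_trans; [apply HB; lia|apply Rmax_l]. }
destruct (fin N) as (B & B1 & HB).
apply Rle_lt_trans with (Rmax B (1 / 2)); [|apply Rmax_lub_lt; lra].
apply c0_norm_lub; intros n.
destruct (Nat.lt_ge_cases n N) as [h|h].
- eapply Rle_trans; [now apply HB|apply Rmax_l].
- eapply Rle_trans; [|apply Rmax_r]; left.
  replace (y n) with (y n - 0)%C by ring; exact (HN n h).
Qed.

Section Isomorphism.

Variables (X : NormedModule C_AbsRing) (e : nat -> X) (r : nat -> R) (delta : R).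
Hypothesis complete : sequentially_complete X.
Hypothesis he : schauder_basis e.
Hypothesis he1 : normalized e.
Hypothesis delta0 : 0 < delta.
Hypothesis hr : forall n, delta <= r n.

Let r_pos n : 0 < r n.
Proof. specialize (hr n); lra. Qed.

Let r_neq n : RtoC (r n) <> 0.
Proof. intros E; apply RtoC_inj in E; specialize (r_pos n); lra. Qed.

Let Cmod_div_r (c : C) n : Cmod (c / r n) = Cmod c / r n.
Proof.
rewrite Cmod_div by apply r_neq; f_equal.
rewrite Cmod_R; apply Rabs_right; specialize (r_pos n); lra.
Qed.

(** * The coordinate map and its finite lifts *)

Lemma basis_ext (x y : X) : (forall j, coef e j x = coef e j y) -> x = y.
Proof.
intros H; apply (filterlim_locally_unique (F := eventually) (basis_sum X e x)).
- now apply basis_sum_lim.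
- apply (filterlim_ext (basis_sum X e y)); [|now apply basis_sum_lim].
  intros n; apply sum_n_ext; intros j; now rewrite H.
Qed.

(** The terms of the convergent expansion of [x] tend to 0, their norms are the moduli of the
    coefficients, and dividing by [r j >= delta] keeps the limit 0. *)
Lemma coef_lim (x : X) : filterlim (fun j => (coef e j x / r j)%C) eventually (locally (RtoC 0)).
Proof.
apply (filterlim_eventually_norm (V := C_NormedModule)); intros eps heps.
destruct (proj1 (filterlim_eventually_norm _ _) (basis_sum_lim X e he x) (eps * delta / 2)) as [N HN].
{ assert (0 < eps * delta) by now apply Rmult_lt_0_compat.
  lra. }
exists (S N); intros [|n] hn; [lia|].
change (Cmod (coef e (S n) x / r (S n) - 0) < eps).
replace (coef e (S n) x / r (S n) - 0)%C with (coef e (S n) x / r (S n))%C by ring.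
rewrite Cmod_div_r; apply Rlt_div_l; [apply r_pos|].
apply Rlt_le_trans with (eps * delta); [|apply Rmult_le_compat_l; [lra|apply hr]].
replace (Cmod (coef e (S n) x)) with (norm (scal (coef e (S n) x) (e (S n))))
  by (rewrite norm_scal_C, he1; ring).
replace (scal (coef e (S n) x) (e (S n))) with (minus (basis_sum X e x (S n)) (basis_sum X e x n)).
- eapply Rle_lt_trans; [apply (dist_triangle x)|].
  rewrite (dist_sym x).
  assert (A1 := HN n ltac:(lia)); assert (A2 := HN (S n) ltac:(lia)); lra.
- unfold basis_sum; rewrite sum_Sn; apply (minus_plus_l (V := X)).
Qed.

Definition coordinates (x : X) : c0 := mkc0 (fun j => (coef e j x / r j)%C) (coef_lim x).

Lemma coordinates_linear : is_linear (coordinates : X -> c0_NormedModule).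
Proof.
split.
- intros x y; apply c0_ext; intros n; simpl; rewrite coef_plus by exact he.
  field; apply r_neq.
- intros k x; apply c0_ext; intros n; simpl; rewrite coef_scal by exact he.
  field; apply r_neq.
- destruct (coef_bounded X e he he1 complete) as (K & K0 & HK).
  exists (K / delta); split; [now apply Rdiv_lt_0_compat|]; intros x.
  apply c0_norm_lub; intros n; simpl; rewrite Cmod_div_r.
  apply Rle_div_l; [apply r_pos|].
  apply Rle_trans with (K / delta * norm x * delta).
  + replace (K / delta * norm x * delta) with (K * norm x) by (field; lra); apply HK.
  + apply Rmult_le_compat_l; [|apply hr].
    apply Rmult_le_pos; [apply Rlt_le, Rdiv_lt_0_compat; lra|apply norm_ge_0].
Qed.

Lemma polydisc_coordinates (x : X) :
  polydisc e r x <-> open_unit_ball c0_NormedModule (coordinates x).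
Proof.
split.
- intros [_ H]; apply c0_norm_lt_1; intros n; simpl; rewrite Cmod_div_r.
  apply Rlt_div_l; [apply r_pos|]; rewrite Rmult_1_l; apply H.
- intros H; split; [now apply coef_series|]; intros j.
  assert (A := Rle_lt_trans _ _ _ (c0_norm_ub (coordinates x) j) H); simpl in A.
  rewrite Cmod_div_r in A; apply Rlt_div_l in A; [lra|apply r_pos].
Qed.

(** A right inverse of [coordinates] on sequences supported in [0..n]; it must be truncated because
    the whole series may diverge in [X]. *)
Definition lift (n : nat) (y : c0) : X := sum_n (fun j => scal (y j * r j)%C (e j)) n.

(** The bound obtained is [r 0 + ... + r n], which grows with [n]: it gives holomorphy of each
    [g (lift n y)] separately, not an estimate uniform in [n]. *)
Lemma lift_linear n : is_linear (lift n : c0_NormedModule -> X).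
Proof.
split.
- intros x y; unfold lift; etransitivity; [|apply sum_n_plus].
  apply sum_n_ext; intros j.
  etransitivity; [|exact (scal_distr_r (x j * r j : C_Ring)%C (y j * r j)%C (e j))].
  f_equal; unfold plus; simpl; ring.
- intros k x; unfold lift.
  etransitivity; [|exact (sum_n_scal_l (K := C_Ring) (V := X) k (fun j => scal (x j * r j)%C (e j)) n)].
  apply sum_n_ext; intros j.
  etransitivity; [|symmetry; exact (scal_assoc (k : C_Ring) (x j * r j)%C (e j))].
  f_equal; unfold mult, scal; simpl; ring.
- assert (term : forall (y : c0) j, norm (scal (y j * r j)%C (e j)) <= r j * c0_norm y).
  { intros y j; rewrite norm_scal_C, he1, Rmult_1_r, Cmod_mult, Rmult_comm.
    specialize (r_pos j); rewrite Cmod_R, Rabs_right by lra.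
    apply Rmult_le_compat_l; [lra|apply c0_norm_ub]. }
  induction n as [|n (M & M0 & HM)].
  + exists (r O); split; [apply r_pos|]; intros y.
    unfold lift; rewrite sum_O; apply term.
  + exists (M + r (S n)); split; [specialize (r_pos (S n)); lra|]; intros y.
    unfold lift; rewrite sum_Sn; eapply Rle_trans; [apply (norm_triangle (V := X))|].
    rewrite Rmult_plus_distr_r; apply Rplus_le_compat; [apply HM|apply term].
Qed.

Lemma coef_lift n (y : c0) j :
  coef e j (lift n y) = if le_dec j n then (y j * r j)%C else RtoC 0.
Proof.
apply (coef_unique X e he (fun j => if le_dec j n then (y j * r j)%C else RtoC 0)).
assert (E : forall m, sum_n (fun i => scal (if le_dec i n then (y i * r i)%C else RtoC 0) (e i)) (m + n)
  = lift n y).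
{ intros m; induction m as [|m IH]; simpl.
  - apply sum_n_ext_loc; intros i hi; destruct (le_dec i n); [reflexivity|lia].
  - rewrite sum_Sn; etransitivity; [apply (f_equal2 plus); [exact IH|]|apply plus_zero_r].
    destruct (le_dec (S (m + n)) n); [lia|exact (scal_zero_l (e (S (m + n))))]. }
apply filterlim_eventually_norm; intros eps heps; exists n; intros m hm.
replace m with ((m - n) + n)%nat by lia.
rewrite E, norm_minus_self; exact heps.
Qed.

Lemma coordinates_lift n (y : c0) j :
  coordinates (lift n y) j = if le_dec j n then y j else RtoC 0.
Proof.
simpl; rewrite coef_lift; destruct (le_dec j n); field; apply r_neq.
Qed.

Lemma lift_coordinates n (x : X) : lift n (coordinates x) = basis_sum X e x n.
Proof.
apply sum_n_ext; intros j; simpl; f_equal; field; apply r_neq.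
Qed.

Lemma lift_coordinates_lift n m (y : c0) : (n <= m)%nat -> lift m (coordinates (lift n y)) = lift n y.
Proof.
intros hnm; apply basis_ext; intros j; rewrite coef_lift, coordinates_lift, coef_lift.
destruct (le_dec j m), (le_dec j n); try lia; ring.
Qed.

Lemma norm_coordinates_lift n (y : c0) : c0_norm (coordinates (lift n y)) <= c0_norm y.
Proof.
apply c0_norm_lub; intros j; rewrite coordinates_lift; destruct (le_dec j n).
- apply c0_norm_ub.
- rewrite Cmod_0; eapply Rle_trans; [apply Cmod_ge_0|apply (c0_norm_ub y O)].
Qed.

Lemma coordinates_lift_lim (y : c0) :
  filterlim (fun n => coordinates (lift n y) : c0_NormedModule) eventually
    (locally (y : c0_NormedModule)).
Proof.
apply (filterlim_eventually_norm (V := c0_NormedModule)); intros eps heps.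
destruct (proj1 (filterlim_eventually_norm (V := C_NormedModule) _ _) (c0_lim y) (eps / 2)) as [N HN]; [lra|].
exists N; intros n hn.
apply Rle_lt_trans with (eps / 2); [|lra].
apply c0_norm_lub; intros j.
change (Cmod (coordinates (lift n y) j + (- (1)) * y j) <= eps / 2).
rewrite coordinates_lift; destruct (le_dec j n).
- replace (y j + (- (1)) * y j)%C with (RtoC 0) by ring; rewrite Cmod_0; lra.
- replace (0 + (- (1)) * y j)%C with (- (y j - 0))%C by ring; rewrite Cmod_opp.
  left; apply (HN j); lia.
Qed.

Lemma lift_polydisc n (y : c0) : open_unit_ball c0_NormedModule y -> polydisc e r (lift n y).
Proof.
intros hy; apply polydisc_coordinates.
exact (Rle_lt_trans _ _ _ (norm_coordinates_lift n y) hy).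
Qed.

(** * Composition with the coordinate map *)

Definition pullback (f : Hinf (open_unit_ball c0_NormedModule)) : Hinf (polydisc e r).
Proof.
refine (mkHinf (fun x => f (coordinates x)) _ _ _).
- intros x Ux; apply polydisc_coordinates in Ux.
  destruct (Hfun_holo f _ Ux) as [l Hl].
  exists (fun h => l (coordinates h)).
  apply (filterdiff_comp' (V := c0_NormedModule) (W := C_NormedModule) coordinates f x coordinates l);
    [|exact Hl].
  apply filterdiff_linear, coordinates_linear.
- destruct (Hfun_bounded f) as [M HM]; exists M; intros x Ux.
  now apply HM, polydisc_coordinates.
- intros x Ux; apply Hfun_out; intros h; now apply Ux, polydisc_coordinates.
Defined.

(** The values of [f] on the ball are limits of its values at coordinates of polydisc points. Both
    injectivity and isometry of [pullback] rest on this. *)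
Lemma Hinf_lift_lim (f : Hinf (open_unit_ball c0_NormedModule)) (y : c0) :
  open_unit_ball c0_NormedModule y ->
  filterlim (fun n => f (coordinates (lift n y))) eventually (locally (f y)).
Proof.
intros hy.
apply (filterlim_comp _ _ _ (fun n => coordinates (lift n y)) f _ (locally (y : c0_NormedModule))).
- apply coordinates_lift_lim.
- apply (filterdiff_continuous (V := C_NormedModule) f), Hfun_holo, hy.
Qed.

Lemma pullback_inj (f g : Hinf (open_unit_ball c0_NormedModule)) : pullback f = pullback g -> f = g.
Proof.
intros E; apply Hinf_ext; intros y hy.
apply (filterlim_locally_unique (V := C_NormedModule) (F := eventually)
  (fun n => f (coordinates (lift n y)))).
- now apply Hinf_lift_lim.
- apply (filterlim_ext (fun n => g (coordinates (lift n y)))); [|now apply Hinf_lift_lim].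
  intros n; exact (f_equal (fun h : Hinf (polydisc e r) => h (lift n y)) (eq_sym E)).
Qed.

Lemma pullback_norm (f : Hinf (open_unit_ball c0_NormedModule)) :
  Hinf_norm (pullback f) = Hinf_norm f.
Proof.
unfold Hinf_norm; f_equal; apply is_lub_Rbar_unique.
destruct (Lub_Rbar_correct (fun t => exists y, open_unit_ball c0_NormedModule y /\ t = Cmod (f y)))
  as [ub lub].
split.
- intros t (x & Ux & ->); apply ub.
  exists (coordinates x); split; [now apply polydisc_coordinates|reflexivity].
- intros b Hb; apply lub; intros t (y & hy & ->).
  assert (Hn : forall n, Rbar_le (Cmod (f (coordinates (lift n y)))) b).
  { intros n; apply Hb; exists (lift n y); split; [now apply lift_polydisc|reflexivity]. }
  destruct b as [b| |]; simpl in *; [|exact I|exact (Hn O)].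
  apply (filterlim_norm_le (V := C_NormedModule) (fun n => f (coordinates (lift n y)))); [|exact Hn].
  now apply Hinf_lift_lim.
Qed.

Lemma ball_around (y z : c0_NormedModule) : norm (minus z y) < 1 - norm y ->
  open_unit_ball c0_NormedModule z.
Proof.
intros h; unfold open_unit_ball.
assert (A := norm_triangle_inv z y); apply Rabs_le_between in A; lra.
Qed.

Section Extension.

Variable g : Hinf (polydisc e r).

Lemma lift_holo n (y : c0_NormedModule) : open_unit_ball c0_NormedModule y ->
  ex_filterdiff (fun y => g (lift n y)) (locally y).
Proof.
intros hy; destruct (Hfun_holo g _ (lift_polydisc n y hy)) as [l Hl].
exists (fun h => l (lift n h)).
apply (filterdiff_comp' (U := c0_NormedModule) (W := C_NormedModule) (lift n) g y (lift n) l);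
  [|exact Hl].
apply filterdiff_linear, lift_linear.
Qed.

(* [g (lift n y) = g (lift m (P_n y))] for all [m >= n], where [P_n] truncates [y], and
   the functions [g o lift m] are equi-Lipschitz near [y] because they are equibounded. *)
Lemma lift_lim (y : c0_NormedModule) : open_unit_ball c0_NormedModule y ->
  exists l : C, filterlim (fun n => g (lift n y)) eventually (locally l).
Proof.
intros hy; apply (CompleteNormedModule_sequentially_complete C_CompleteNormedModule); intros eps heps.
destruct (Hfun_bounded g) as [M HM].
assert (M0 : 0 <= M) by (eapply Rle_trans; [apply Cmod_ge_0|apply (HM _ (lift_polydisc O y hy))]).
set (rho := 1 - norm y).
assert (rho0 : 0 < rho) by (unfold rho, open_unit_ball in *; lra).
set (L := 16 * M / rho).
assert (L0 : 0 <= L) by (apply Rdiv_le_0_compat; lra).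
(* Two truncations within [t] of [y] are closer to each other than [rho / 2], as the Lipschitz bound
   requires, and than [eps / (L + 1)], which gives the conclusion. *)
set (t := Rmin (rho / 2) (eps / (L + 1)) / 2).
assert (m0 : 0 < Rmin (rho / 2) (eps / (L + 1))).
{ apply Rmin_glb_lt; [lra|apply Rdiv_lt_0_compat; lra]. }
destruct (proj1 (filterlim_eventually_norm (V := c0_NormedModule) _ _) (coordinates_lift_lim y) t)
  as [N HN]; [unfold t; lra|].
exists N; intros n m hn hm.
set (yn := coordinates (lift n y) : c0_NormedModule).
set (ym := coordinates (lift m y) : c0_NormedModule).
assert (D : norm (minus yn ym) < Rmin (rho / 2) (eps / (L + 1))).
{ eapply Rle_lt_trans; [apply (dist_triangle (y : c0_NormedModule))|].
  rewrite (dist_sym (y : c0_NormedModule)).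
  assert (A1 := HN n hn); assert (A2 := HN m hm); fold yn in A1; fold ym in A2; unfold t in *; lra. }
assert (D1 := Rlt_le_trans _ _ _ D (Rmin_l _ _)); assert (D2 := Rlt_le_trans _ _ _ D (Rmin_r _ _)).
(* Truncation does not increase the norm, so the radius [rho] fixed at [y] also works around every
   [ym]. *)
assert (near : forall z : c0_NormedModule, norm (minus z ym) < rho -> open_unit_ball c0_NormedModule z).
{ intros z hz; apply (ball_around ym).
  assert (B := norm_coordinates_lift m y : norm ym <= norm y); unfold rho in hz; lra. }
assert (H := holomorphic_lipschitz c0_NormedModule (fun y => g (lift (max n m) y)) ym (minus yn ym) rho M
  rho0 (fun z hz => lift_holo _ z (near z hz)) (fun z hz => HM _ (lift_polydisc _ z (near z hz)))
  ltac:(lra)).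
cbv beta in H; rewrite plus_minus_r in H.
unfold yn at 1, ym at 1 in H.
rewrite !lift_coordinates_lift in H by lia.
change (Cmod (g (lift n y) - g (lift m y)) < eps).
eapply Rle_lt_trans; [exact H|]; fold L.
apply Rlt_div_r in D2; [|lra].
assert (Z := norm_ge_0 (minus yn ym)); nra.
Qed.

Lemma pullback_surj : exists f, pullback f = g.
Proof.
(* The value 0 outside the ball is the one that [Hinf] prescribes. *)
assert (exF : forall y : c0_NormedModule, exists l : C,
  (open_unit_ball c0_NormedModule y -> filterlim (fun n => g (lift n y)) eventually (locally l)) /\
  (~ open_unit_ball c0_NormedModule y -> l = RtoC 0)).
{ intros y; destruct (classic (open_unit_ball c0_NormedModule y)) as [h|h].
  - destruct (lift_lim y h) as [l Hl]; exists l; tauto.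
  - exists (RtoC 0); tauto. }
destruct (choice _ exF) as [F HF].
destruct (Hfun_bounded g) as [M HM].
assert (FM : forall y, open_unit_ball c0_NormedModule y -> Cmod (F y) <= M).
{ intros y hy; apply (filterlim_norm_le (V := C_NormedModule) (fun n => g (lift n y))).
  - now apply HF.
  - intros n; now apply HM, lift_polydisc. }
assert (dF : forall y, open_unit_ball c0_NormedModule y -> ex_filterdiff F (locally y)).
{ intros y hy.
  apply (holomorphic_limit (fun n y => g (lift n y)) F y (1 - norm y) M).
  - unfold open_unit_ball in hy; lra.
  - intros n z hz; apply lift_holo, (ball_around y z hz).
  - intros n z hz; apply HM, lift_polydisc, (ball_around y z hz).
  - intros z hz; apply HF, (ball_around y z hz). }
exists (mkHinf F dF (ex_intro _ M FM) (fun y hy => proj2 (HF y) hy)).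
apply Hinf_ext; intros x Ux; simpl.
(* At [coordinates x] the lifts are the partial sums of the expansion of [x]; they converge to [x],
   where [g] is continuous, so the limit function takes the value [g x]. *)
apply (filterlim_locally_unique (V := C_NormedModule) (F := eventually) (fun n => g (basis_sum X e x n))).
- apply (filterlim_ext (fun n => g (lift n (coordinates x)))).
  + intros n; f_equal; apply lift_coordinates.
  + now apply HF, polydisc_coordinates.
- apply (filterlim_comp _ _ _ (basis_sum X e x) g _ (locally x)).
  + now apply basis_sum_lim.
  + apply (filterdiff_continuous (V := C_NormedModule) g), Hfun_holo, Ux.
Qed.

End Extension.

Lemma polydisc_isomorphic_ball :
  isometrically_isomorphic_Hinf (polydisc e r) (open_unit_ball c0_NormedModule).
Proof.
(* [T] selects a preimage under [pullback]. Injectivity turns it into the inverse map and carries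
   over the algebraic identities, which hold pointwise for [pullback]. *)
destruct (choice _ pullback_surj) as [T HT].
exists T; repeat split.
- intros f g; apply pullback_inj; rewrite HT.
  apply Hinf_ext; intros x _; simpl.
  now rewrite <- (HT f) at 1; rewrite <- (HT g) at 1.
- intros k f; apply pullback_inj; rewrite HT.
  apply Hinf_ext; intros x _; simpl.
  now rewrite <- (HT f) at 1.
- intros f g; apply pullback_inj; rewrite HT.
  apply Hinf_ext; intros x _; simpl.
  now rewrite <- (HT f) at 1; rewrite <- (HT g) at 1.
- intros f; rewrite <- (HT f) at 2; symmetry; apply pullback_norm.
- intros f; exists (pullback f); apply pullback_inj, HT.
Qed.

End Isomorphism.

Lemma Inf_seq_pos_lower_bound (r : nat -> R) :
  Rbar_lt 0 (Inf_seq (fun n => Finite (r n))) -> exists delta, 0 < delta /\ forall n, delta <= r n.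
Proof.
intros H; assert (I := Inf_seq_correct (fun n => Finite (r n))).
destruct (Inf_seq (fun n => Finite (r n))) as [l| |]; simpl in H, I.
- exists l; split; [exact H|]; intros n; apply Rnot_lt_le; intros h.
  assert (h' : 0 < l - r n) by lra.
  destruct (I (mkposreal _ h')) as [A _]; specialize (A n); simpl in A; lra.
- specialize (I (r O) O); lra.
- contradiction.
Qed.

Theorem theorem3p1 (X : CompleteNormedModule C_AbsRing) (e : nat -> X) (r : nat -> R)
    (hX : infinite_dimensional X)
    (he : schauder_basis e)
    (he1 : normalized e)
    (hr : forall n : nat, 0 < r n)
    (hinf : Rbar_lt 0 (Inf_seq (fun n : nat => Finite (r n)))) :
  isometrically_isomorphic_Hinf (polydisc e r) (open_unit_ball c0_NormedModule).
Proof.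
destruct (Inf_seq_pos_lower_bound r hinf) as (delta & delta0 & Hdelta).
exact (polydisc_isomorphic_ball X e r delta (CompleteNormedModule_sequentially_complete X)
  he he1 delta0 Hdelta).
Qed.
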